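(* Let $X$ be a Polish space and $N\ge2$. Let $Z=(Z_1,\dots,Z_N)$ be a finitely exchangeable sequence of random variables with values in $X$, let $\mu\in\mathcal P_{\mathrm{sym}}(X^N)$ be the law of $Z$, and let $\alpha\in\mathcal P(\mathcal P(X))$ be such that $\alpha(\mathcal P_{\frac1N}(X))=1$ and $$\mu=\int_{\mathcal P_{\frac1N}(X)}F_{N,N}(\lambda)\,d\alpha(\lambda).$$ Let $(Z^{(\nu)})_{\nu\in\mathbb N}$ be i.i.d. drawn according to $\mu$, and consider the $\mathcal P(X)$-valued sequence $$\Lambda(Z^{(\nu)}):=\frac1N\sum_{i=1}^N\delta_{Z_i^{(\nu)}}.$$ Then, almost surely, the empirical measure $\frac1n\sum_{\nu=1}^n\delta_{\Lambda(Z^{(\nu)})}$ converges narrowly to $\alpha$ as $n\to\infty$.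
   Context: $\mathcal P(Y)$ denotes the Borel probability measures on a Polish space $Y$, with the narrow topology (convergence tested against bounded continuous functions); $\mathcal P(X)$ is itself Polish, and narrow convergence in $\mathcal P(\mathcal P(X))$ is understood accordingly. $(Z_1,\dots,Z_N)$ is finitely exchangeable if its law equals that of $(Z_{\sigma(1)},\dots,Z_{\sigma(N)})$ for every permutation $\sigma$ of $\{1,\dots,N\}$. For $\gamma\in\mathcal P(X^N)$, $\gamma^\sigma$ is defined by $\int\varphi\,d\gamma^\sigma=\int\varphi(x_{\sigma(1)},\dots,x_{\sigma(N)})\,d\gamma$, $S_N\gamma=\frac1{N!}\sum_\sigma\gamma^\sigma$ (extended linearly to finite signed measures), and $\mathcal P_{\mathrm{sym}}(X^N)=\{\gamma\in\mathcal P(X^N):S_N\gamma=\gamma\}$. $\mathcal P_{\frac1N}(X)=\{\frac1N\sum_{i=1}^N\delta_{x_i}: x_1,\dots,x_N\in X\text{ not necessarily distinct}\}$. For $\lambda\in\mathcal P(X)$, $\lambda^{\otimes m}$ is the $m$-fold product (factor omitted if $m=0$) and $\mathrm{id}^{\otimes m}_\#\lambda$ the push-forward of $\lambda$ under $x\mapsto(x,\dots,x)\in X^m$. A partition of $j\in\mathbb N$ of length $n$ is $\mathbf p=(p_1\ge\dots\ge p_n)\in\mathbb N^n$ ($\mathbb N=\{1,2,\dots\}$) with $\sum p_i=j$; $n(\mathbf p)=n$; $\mathrm{Ran}\,\mathbf p$ is the set of values of its components and $|\mathbf p^{-1}(q)|$ the number of components equal to $q$. $F_{N,N}$ is the case $k=N$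 of $$F_{N,k}(\lambda)=\frac{N^{k-1}}{\prod_{i=1}^{k-1}(N-i)}\Big[\lambda^{\otimes k}+\sum_{j=1}^{k-1}\frac{(-1)^j}{N^j}S_kP_j^{(k)}(\lambda)\Big],$$ $$P_j^{(k)}(\lambda)=\sum_{\substack{\mathbf p\text{ partition of }j\\ j+n(\mathbf p)\le k}}d_{\mathbf p}^{(k)}\,\mathrm{id}^{\otimes(p_1+1)}_\#\lambda\otimes\cdots\otimes\mathrm{id}^{\otimes(p_{n(\mathbf p)}+1)}_\#\lambda\otimes\lambda^{\otimes(k-j-n(\mathbf p))},$$ $$d_{\mathbf p}^{(k)}=\frac{k!}{(k-j-n(\mathbf p))!}\prod_{i=1}^{n(\mathbf p)}\frac1{p_i+1}\prod_{q\in\mathrm{Ran}\,\mathbf p}\frac1{(|\mathbf p^{-1}(q)|)!}.$$ The integral formula for $\mu$ means that $\int\varphi\,d\mu=\int\big(\int\varphi\,dF_{N,N}(\lambda)\big)d\alpha(\lambda)$ for all bounded continuous $\varphi$ on $X^N$. *)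

(* Defs.v *)
From HB Require Import structures.
From mathcomp Require Import all_boot all_order all_algebra all_fingroup finmap.
From mathcomp Require Import all_classical all_reals all_analysis.
From mathcomp Require Import zify.

Set Implicit Arguments.
Unset Strict Implicit.
Unset Printing Implicit Defensive.

Import Order.TTheory GRing.Theory Num.Theory.
Import numFieldNormedType.Exports.

Local Open Scope classical_set_scope.
Local Open Scope ring_scope.

Definition polish (R : realType) (X : topologicalType) : Prop :=
  (exists2 D : set X, countable D & dense D) /\
  exists dist : X -> X -> R,
    [/\ (forall x y, dist x y = 0 <-> x = y),
        (forall x y, dist x y = dist y x),
        (forall x y z, dist x z <= dist x y + dist y z),
        (forall x (A : set X),
           nbhs x A <-> exists2 e, 0 < e & [set y | dist x y < e] `<=` A)
      & (forall u : nat -> X,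
           (forall e, 0 < e -> exists n0, forall m n,
              (n0 <= m)%N -> (n0 <= n)%N -> dist (u m) (u n) < e) ->
           exists l : X, u @ \oo --> l)].

Definition borel (Y : ptopologicalType) := g_sigma_algebraType (@open Y).

Definition bounded_continuous (R : realType) (Y : topologicalType)
    (phi : Y -> R) : Prop :=
  continuous phi /\ exists M : R, forall y, `|phi y| <= M.

(* Two elements of [Pr R Y] may agree on all Borel sets and yet differ as
   records, because a [probability] is a function on all subsets of [Y].
   Equality of measures is therefore always expressed by [meas_eq]. *)
Definition Pr (R : realType) (Y : ptopologicalType) : Type :=
  probability (borel Y) R.

Definition meas_eq d (T : measurableType d) (R : realType)
    (m1 m2 : set T -> \bar R) : Prop :=
  forall A, measurable A -> m1 A = m2 A.

Definition narrow_eval (R : realType) (Y : ptopologicalType)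
    (m : probability (borel Y) R) :
    {ptws {phi : Y -> R | bounded_continuous phi} -> R} :=
  fun phi => \int[m]_y sval phi y.

HB.instance Definition _ (R : realType) (Y : ptopologicalType) :=
  Pointed.copy (Pr R Y) (probability (borel Y) R).
HB.instance Definition _ (R : realType) (Y : ptopologicalType) :=
  Topological.copy (Pr R Y) (initial_topology (@narrow_eval R Y)).

Lemma cvg_initial (S : choiceType) (T : topologicalType) (f : S -> T)
    (F : set_system S) (s : S) : Filter F ->
  F --> (s : initial_topology f) <-> f @ F --> f s.
Proof.
move=> FF; split=> [Fs A /=|fFs A].
  move=> /initial_continuous; exact: Fs.
rewrite nbhsE => -[_ [[C oC <-] Cs] CA].
apply: filterS CA _; apply: fFs; exact: open_nbhs_nbhs.
Qed.

Lemma cvg_ptws (I : Type) (T : topologicalType) (F : set_system (I -> T))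
    (f : I -> T) : Filter F ->
  {ptws, F --> f} <-> forall i, (fun g : I -> T => g i) @ F --> f i.
Proof.
move=> FF; rewrite cvg_sup; split=> Ff i.
- exact: (cvg_initial (fun g : I -> T => g i) f FF).1 (Ff i).
- exact: (cvg_initial (fun g : I -> T => g i) f FF).2 (Ff i).
Qed.

Lemma narrow_cvgP (R : realType) (Y : ptopologicalType)
    (F : set_system (Pr R Y)) (m : Pr R Y) : Filter F ->
  F --> m <->
  forall phi : Y -> R, bounded_continuous phi ->
    (fun m' : Pr R Y => \int[m']_y phi y) @ F --> \int[m]_y phi y.
Proof.
move=> FF; rewrite (cvg_initial (@narrow_eval R Y)) cvg_ptws.
by split=> [Fm phi bphi|Fm [phi bphi]]; [exact: (Fm (exist _ phi bphi))|exact: Fm].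
Qed.

Definition empirical (R : realType) (Y : ptopologicalType) (y : nat -> Y)
    (n : nat) : Pr R Y :=
  mnormalize (msum (fun i => \d_(y i : borel Y)) n) \d_(point : borel Y).

Lemma empiricalE (R : realType) (Y : ptopologicalType) (y : nat -> Y)
    (n : nat) (A : set Y) : (0 < n)%N ->
  empirical R y n A = ((n%:R^-1)%:E * \sum_(i < n) \d_(y i : borel Y) A)%E.
Proof.
move=> n0; pose m : {measure set (borel Y) -> \bar R} := msum (fun i => \d_(y i : borel Y)) n.
have E : m setT = n%:R%:E :> \bar R.
  rewrite [LHS](eq_bigr (fun=> 1%E)) => [|i _]; last exact: diracT.
  by rewrite sumEFin sumr_const card_ord.
rewrite -[LHS]/(mnormalize m \d_(point : borel Y) A) /mnormalize E/=.
by rewrite eqe pnatr_eq0 gtn_eqF//= muleC.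
Qed.

Definition Lam (R : realType) (X : ptopologicalType) (N : nat) (x : N.-tuple X) :
  Pr R X := empirical R (nth point x) N.

Definition Pr_frac (R : realType) (X : ptopologicalType) (N : nat) :
  set (Pr R X) := [set l | exists x : N.-tuple X, meas_eq l (Lam R x)].

(* The measurable structure on [n.-tuple (borel X)] is the product of the Borel
   sigma-algebras; for Polish [X] it is the Borel sigma-algebra of [tuple_top]
   (lemma [borel_tuple]). *)
Definition tuple_top (n : nat) (X : topologicalType) :=
  initial_topology (fun t : n.-tuple X => (tnth t : {ptws 'I_n -> X})).

Lemma borel_tuple (R : realType) (X : ptopologicalType) n : polish R X ->
  (measurable : set (set (n.-tuple (borel X)))) = <<s @open (tuple_top n X)>>.
Proof.
move=> [[D cD dD] [dist [dist0 distC distT nbhsD _]]].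
have coord i : continuous (fun t : tuple_top n X => tnth t i).
  move=> t; have := @cvg_id _ (nbhs t).
  rewrite -[X in _ --> X]/(nbhs (t : initial_topology (fun t : n.-tuple X => (tnth t : {ptws 'I_n -> X})))).
  move=> /(cvg_initial (fun t : n.-tuple X => (tnth t : {ptws 'I_n -> X}))).
  by move=> /cvg_ptws; exact.
apply/seteqP; split.
  rewrite {1}/measurable/= /g_sigma_preimage.
  apply: smallest_sub; first exact: smallest_sigma_algebra.
  move=> A; rewrite -bigcup_seq => -[i _ [B mB <-]]; rewrite setTI.
  suff : measurable_fun setT
      (fun t : g_sigma_algebraType (@open (tuple_top n X)) => tnth t i : borel X).
    by move=> /(_ measurableT B mB); rewrite setTI.
  apply: (@measurability _ _ _ (borel X) setT _ (@open X)) => // _ [C oC <-]; rewrite setTI.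
  by apply: sub_sigma_algebra; move/continuousP: (coord i); exact.
apply: smallest_sub; first exact: sigma_algebra_measurable.
have ball_open x e : open [set y | dist x y < e].
  rewrite openE => y /= xy; apply/nbhsD; exists (e - dist x y).
    by rewrite subr_gt0.
  by move=> z /=; rewrite ltrBrDl; exact: le_lt_trans.
have [f fD] : exists f : nat -> X, D `<=` range f.
  have /pfcard_geP[->|[f]] := cD; first by exists (fun=> point).
  by exists f => x Dx; have [k _ <-] := @surj _ _ _ _ f x Dx; exists k.
pose box (c : n.-tuple nat * nat) : set (n.-tuple X) :=
  [set t | forall i, dist (f (tnth c.1 i)) (tnth t i) < c.2.+1%:R^-1].
have mbox c : measurable (box c : set (n.-tuple (borel X))).
  have -> : box c = \big[setI/setT]_(i < n)
      ((tnth (T:=borel X))^~ i @^-1` [set y | dist (f (tnth c.1 i)) y < c.2.+1%:R^-1]).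
    apply/seteqP; split => t /=.
      by move=> ct; rewrite -bigcap_seq => i _; exact: ct.
    by rewrite -bigcap_seq => ct i; apply: ct; rewrite /= mem_index_enum.
  apply: bigsetI_measurable => i _; rewrite -[X in measurable X]setTI.
  apply: measurable_tnth => //; apply: sub_sigma_algebra; exact: ball_open.
move=> U oU.
have -> : U = \bigcup_(c in setT) (if `[< box c `<=` U >] then box c else set0).
  apply/seteqP; split => [t Ut|t [c _]]; last by case: asboolP => // + bct; exact.
  have [k kU] : exists k, (fun s : n.-tuple X =>
      forall i, dist (tnth t i) (tnth s i) < k.+1%:R^-1) `<=` U.
    pose G : set_system (n.-tuple X) := filter_from setT (fun k =>
       (fun s : n.-tuple X => forall i, dist (tnth t i) (tnth s i) < k.+1%:R^-1)).
    have GF : Filter G.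
      apply: filter_from_filter; first by exists 0%N.
      move=> a b _ _; exists (maxn a b) => // s sab; split=> i.
        apply: lt_le_trans (sab i) _.
        by rewrite lef_pV2 ?posrE// ler_nat ltnS leq_maxl.
      apply: lt_le_trans (sab i) _.
      by rewrite lef_pV2 ?posrE// ler_nat ltnS leq_maxr.
    have : G --> (t : tuple_top n X).
      apply/cvg_initial/cvg_ptws => i A /nbhsD[e e0 eA] /=.
      near \oo => k; exists k => // s ks; apply: eA => /=.
      apply: lt_trans (ks i) _; near: k; exact: near_infty_natSinv_lt (PosNum e0).
    move=> /(_ U)/=; have /[swap]/[apply] : nbhs (t : tuple_top n X) U.
      exact: open_nbhs_nbhs.
    by case=> k _ kU; exists k.
  pose K := (k.+1).*2.
  have Kpos : (0 : R) < K.+1%:R^-1 by rewrite invr_gt0.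
  have /choice[c cP] : forall i, exists a, dist (f a) (tnth t i) < K.+1%:R^-1.
    move=> i; have := dD [set y | dist (tnth t i) y < K.+1%:R^-1] _ (ball_open _ _).
    case; first by exists (tnth t i); rewrite /= (dist0 _ _).2.
    by move=> x [/= tx /fD[a _ ax]]; exists a; rewrite ax distC.
  exists ([tuple c i | i < n], K) => //; rewrite asboolT; last first.
    move=> s bs; apply: kU => i.
    have := bs i; rewrite tnth_mktuple/= => si.
    apply: (le_lt_trans (distT _ (f (c i)) _)).
    apply: (lt_trans (ltrD (_ : _ < K.+1%:R^-1) si)).
      by rewrite distC.
    rewrite -mulr2n -[X in X < _]mulr_natl ltr_pdivrMr// mulrC ltr_pdivlMr//.
    by rewrite -natrM ltr_nat /K; lia.
  by move=> i; rewrite tnth_mktuple.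
apply: countable_bigcupT_measurable => [|c]; first exact: countableP.
by case: asboolP.
Unshelve. all: by end_near. Qed.

Section tuple_maps.
Context d (T : measurableType d).

Definition tuple_cat m n (uv : m.-tuple T * n.-tuple T) : (m + n).-tuple T :=
  cat_tuple uv.1 uv.2.

Lemma measurable_tuple_cat m n : measurable_fun setT (@tuple_cat m n).
Proof.
apply/measurable_fun_tnthP => i; case: (splitP i) => j ij.
- have -> : (tnth (T:=T))^~ i \o @tuple_cat m n = (tnth (T:=T))^~ j \o fst.
    apply/funext => -[u v] /=; rewrite (tnth_nth point) /= nth_cat size_tuple.
    by rewrite ij ltn_ord (tnth_nth point).
  by apply: measurableT_comp; [exact: measurable_tnth|exact: measurable_fst].
- have -> : (tnth (T:=T))^~ i \o @tuple_cat m n = (tnth (T:=T))^~ j \o snd.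
    apply/funext => -[u v] /=; rewrite (tnth_nth point) /= nth_cat size_tuple.
    by rewrite ij ltnNge leq_addr addKn (tnth_nth point).
  by apply: measurableT_comp; [exact: measurable_tnth|exact: measurable_snd].
Qed.
HB.instance Definition _ m n :=
  isMeasurableFun.Build _ _ _ _ (@tuple_cat m n) (@measurable_tuple_cat m n).

Definition tuple_diag n (x : T) : n.-tuple T := nseq_tuple n x.

Lemma measurable_tuple_diag n : measurable_fun setT (@tuple_diag n).
Proof.
apply/measurable_fun_tnthP => i.
rewrite (_ : _ \o _ = id); first exact: measurable_id.
by apply/funext => x /=; rewrite (tnth_nth point)/= nth_nseq ltn_ord.
Qed.
HB.instance Definition _ n :=
  isMeasurableFun.Build _ _ _ _ (@tuple_diag n) (@measurable_tuple_diag n).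

Definition tuple_perm n (s : 'S_n) (t : n.-tuple T) : n.-tuple T :=
  [tuple tnth t (s i) | i < n].

Lemma measurable_tuple_perm n (s : 'S_n) : measurable_fun setT (tuple_perm s).
Proof.
apply/measurable_fun_tnthP => i.
rewrite (_ : _ \o _ = (tnth (T:=T))^~ (s i)); first exact: measurable_tnth.
by apply/funext => x /=; rewrite tnth_mktuple.
Qed.
HB.instance Definition _ n (s : 'S_n) :=
  isMeasurableFun.Build _ _ _ _ (tuple_perm s) (@measurable_tuple_perm n s).

(* In the measures below [m = \sum_i (p_i + 1) + (k - j - n(p))], which is equal
   but not convertible to [k]; there the map is the cast along [m = k]
   (lemma [tuple_resizeE]). *)
Definition tuple_resize m k (t : m.-tuple T) : k.-tuple T :=
  [tuple nth point t i | i < k].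

Lemma tuple_resizeE m k (e : m = k) (t : m.-tuple T) :
  tuple_resize k t = tcast e t.
Proof.
apply: eq_from_tnth => i.
by rewrite tnth_mktuple tcastE (tnth_nth point).
Qed.

Lemma measurable_tuple_resize m k : measurable_fun setT (@tuple_resize m k).
Proof.
apply/measurable_fun_tnthP => i; case: (ltnP i m) => im.
- rewrite (_ : _ \o _ = (tnth (T:=T))^~ (Ordinal im)); first exact: measurable_tnth.
  by apply/funext => x /=; rewrite tnth_mktuple (tnth_nth point).
- rewrite (_ : _ \o _ = cst point); first exact: measurable_cst.
  by apply/funext => x /=; rewrite tnth_mktuple nth_default ?size_tuple.
Qed.
HB.instance Definition _ m k :=
  isMeasurableFun.Build _ _ _ _ (@tuple_resize m k) (@measurable_tuple_resize m k).

End tuple_maps.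

Section charges.
Context d (T : measurableType d) (R : realType).

Definition csum I (r : seq I) (P : pred I)
    (nu : I -> {charge set T -> \bar R}) : {charge set T -> \bar R} :=
  \big[(fun a b : {charge set T -> \bar R} => cadd a b : {charge set T -> \bar R})
      /(czero : {charge set T -> \bar R})]_(i <- r | P i) nu i.

Lemma csumE I (r : seq I) (P : pred I) (nu : I -> {charge set T -> \bar R}) A :
  csum r P nu A = (\sum_(i <- r | P i) nu i A)%E.
Proof.
rewrite /csum; elim: r => [|i r IH]; first by rewrite !big_nil.
by rewrite !big_cons; case: (P i); rewrite //= -IH.
Qed.

Definition cpush d' (T' : measurableType d') (f : {mfun T >-> T'})
    (nu : {charge set T -> \bar R}) : {charge set T' -> \bar R} :=
  measure_function_pushforward__canonical__charge_Charge nu (measurable_funPT f).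

Lemma cpushE d' (T' : measurableType d') (f : {mfun T >-> T'})
    (nu : {charge set T -> \bar R}) A : cpush f nu A = nu (f @^-1` A).
Proof. by []. Qed.

Definition hahn_pos (nu : {charge set T -> \bar R}) : set T :=
  projT1 (cid (Hahn_decomposition nu)).
Definition hahn_neg (nu : {charge set T -> \bar R}) : set T :=
  projT1 (cid (projT2 (cid (Hahn_decomposition nu)))).
Lemma hahn_posneg (nu : {charge set T -> \bar R}) :
  hahn_decomposition nu (hahn_pos nu) (hahn_neg nu).
Proof. exact: projT2 (cid (projT2 (cid (Hahn_decomposition nu)))). Qed.

Definition charge_int (nu : {charge set T -> \bar R}) (f : T -> R) : R :=
  \int[jordan_pos (hahn_posneg nu)]_x f x -
  \int[jordan_neg (hahn_posneg nu)]_x f x.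

End charges.

Definition symmetrize d (T : measurableType d) (R : realType) (k : nat)
    (nu : {charge set (k.-tuple T) -> \bar R}) :
    {charge set (k.-tuple T) -> \bar R} :=
  cscale (k`!%:R^-1)
    (csum (index_enum 'S_k) xpredT (fun s => cpush (tuple_perm s) nu)).

Definition symmetric_law d (T : measurableType d) (R : realType) (k : nat)
    (mu : probability (k.-tuple T) R) : Prop :=
  meas_eq (symmetrize (charge_of_finite_measure mu)) mu.

Section tensors.
Context d (T : measurableType d) (R : realType).

Definition tensor m n (mu : probability (m.-tuple T) R)
    (nu : probability (n.-tuple T) R) : probability ((m + n).-tuple T) R :=
  distribution (mu \x nu)%E (@tuple_cat _ T m n).

Definition diag (l : probability T R) n : probability (n.-tuple T) R :=
  distribution l (@tuple_diag _ T n).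

Fixpoint power (l : probability T R) m : probability (m.-tuple T) R :=
  if m is m'.+1 then tensor (diag l 1) (power l m') else \d_([tuple] : 0.-tuple T).

Fixpoint blocks (l : probability T R) (p : seq nat) :
    probability ((sumn [seq q.+1 | q <- p]).-tuple T) R :=
  if p is q :: p' then tensor (diag l q.+1) (blocks l p') else \d_([tuple] : 0.-tuple T).

End tensors.

Definition is_partition (j : nat) (p : seq nat) : bool :=
  [&& sorted geq p, all (leq 1) p & sumn p == j].

(* A partition of [j] has at most [j] parts, each at most [j]. *)
Definition partitions (j : nat) : seq (seq nat) :=
  [seq p <- flatten [seq [seq map val (val t) | t <- enum {: n.-tuple 'I_j.+1}]
                    | n <- iota 0 j.+1]
  | is_partition j p].

Lemma mem_partitions j p : (p \in partitions j) = is_partition j p.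
Proof.
rewrite mem_filter; case: (boolP (is_partition j p)) => // /and3P[_ p1 /eqP pj]; rewrite andTb.
have le_size (s : seq nat) : all (leq 1) s -> (size s <= sumn s)%N.
  elim: s => //= x s IH /andP[x1 /IH]; lia.
have le_mem x : x \in p -> (x < j.+1)%N.
  rewrite -pj ltnS; elim: (p) => //= y s IH.
  by rewrite inE => /orP[/eqP ->|/IH]; lia.
apply/flattenP.
exists [seq map val (val t) | t <- enum {: (size p).-tuple 'I_j.+1}].
  apply/mapP; exists (size p) => //.
  by rewrite mem_iota add0n ltnS -pj le_size.
apply/mapP; exists (map_tuple (inord : nat -> 'I_j.+1) (in_tuple p)).
  by rewrite mem_enum.
rewrite /= -map_comp -[LHS]map_id; apply/eq_in_map => x xp /=.
by rewrite inordK ?le_mem.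
Qed.

Lemma partitions_uniq j : uniq (partitions j).
Proof.
apply: filter_uniq.
have : uniq (iota 0 j.+1) by exact: iota_uniq.
elim: (iota 0 j.+1) => //= n s IH /andP[ns us].
rewrite cat_uniq IH// andbT map_inj_uniq ?enum_uniq/=; last first.
  by move=> t t' /(inj_map val_inj)/val_inj.
apply/hasPn => p /flattenP[_ /mapP[m ms ->] /mapP[t _ ->]].
apply/mapP => -[t' _ /(congr1 size)]; rewrite !size_map !size_tuple => mn.
by rewrite -mn ms in ns.
Qed.

Definition dcoef (R : realType) (k : nat) (p : seq nat) : R :=
  k`!%:R / (k - sumn p - size p)`!%:R
  * (\prod_(q <- p) (q.+1%:R)^-1)
  * \prod_(q <- undup p) ((count_mem q p)`!%:R)^-1.

Section Fmeasures.
Context d (T : measurableType d) (R : realType).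

Definition partition_measure (l : probability T R) (k : nat) (p : seq nat) :
    probability (k.-tuple T) R :=
  distribution (tensor (blocks l p) (power l (k - sumn p - size p)))
    (@tuple_resize _ T _ k).

Definition Ppart (k j : nat) (l : probability T R) : {charge set (k.-tuple T) -> \bar R} :=
  csum (partitions j) (fun p => j + size p <= k)%N
    (fun p => cscale (dcoef R k p)
                (charge_of_finite_measure (partition_measure l k p))).

Definition Fmeas (N k : nat) (l : probability T R) : {charge set (k.-tuple T) -> \bar R} :=
  cscale (N%:R ^+ k.-1 / \prod_(1 <= i < k) (N%:R - i%:R))
    (cadd (charge_of_finite_measure (power l k))
       (csum (index_iota 1 k) xpredT
          (fun j => cscale ((-1) ^+ j / N%:R ^+ j)
                      (symmetrize (Ppart k j l))))).

End Fmeasures.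

Definition exchangeable d0 (Om : measurableType d0) (R : realType)
    (P : probability Om R) d (T : measurableType d) (N : nat)
    (Z : 'I_N -> {RV P >-> T}) : Prop :=
  forall (s : 'S_N) (A : set (N.-tuple T)), measurable A ->
    P [set w | A [tuple Z i w | i < N]] = P [set w | A [tuple Z (s i) w | i < N]].

Definition mutually_independent d0 (Om : measurableType d0) (R : realType)
    (P : probability Om R) (I : choiceType) d (T : measurableType d)
    (Z : I -> {RV P >-> T}) : Prop :=
  forall (J : {fset I}) (B : I -> set T), (forall i, measurable (B i)) ->
    P (\bigcap_(i in [set` J]) (Z i @^-1` B i)) =
    (\big[*%E/1%E]_(i <- J) P (Z i @^-1` B i))%E.

Definition iid_with_law d0 (Om : measurableType d0) (R : realType)
    (P : probability Om R) d (T : measurableType d)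
    (Z : nat -> {RV P >-> T}) (mu : probability T R) : Prop :=
  mutually_independent Z /\ forall i, meas_eq (distribution P (Z i)) mu.

(* Main.v *)
Require Import Defs.
From HB Require Import structures.
From mathcomp Require Import all_boot all_order all_algebra all_fingroup finmap.
From mathcomp Require Import all_classical all_reals all_analysis.
From mathcomp Require Import measurable_realfun.
From mathcomp Require Import zify ring lra.

(** A continuous function [Phi] on P(X) gives a continuous symmetric function
    [Phi o Lambda] on X^N, so two facts suffice.  First, the empirical measures
    of the i.i.d. sample [Z^(nu)] converge narrowly to [mu] almost surely
    (Varadarajan), by the law of large numbers along a countable family of sets
    closed under finite unions and generating the topology.  Second,
    [\int Phi o Lambda dmu = \int Phi dalpha]: for a symmetric [phi] and
    [lambda = Lambda(x)], [\int phi dF_{N,N}(lambda) = phi(x)].  Indeed, with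
    power sums replaced by repeated arguments, F_{N,N} is the expansion of the
    elementary symmetric function e_N in power sums, the coefficients d_p
    counting the permutations of a given cycle type; this expansion follows
    from Newton's identities. *)

Set Implicit Arguments.
Unset Strict Implicit.
Unset Printing Implicit Defensive.

Import Order.TTheory GRing.Theory Num.Theory.
Import numFieldNormedType.Exports.

Local Open Scope classical_set_scope.
Local Open Scope ring_scope.

(** * Power sums and elementary symmetric functions *)

(* A function [psi] on words invariant under permutation is a linear functional on
   polynomials, a word standing for the product of its letters: [add_block b psi]
   is [psi (p_b * _)], [powersum psi p] is [psi] of the product of the power sums
   p_b, b in p, and [elem_sym psi n] is [psi e_n]. *)
Section newton.
Context (R : numFieldType) (I : finType).
Implicit Types (psi : seq I -> R) (S : {set I}) (b n m : nat) (p : seq nat).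

(** The exceptional null set must serve uncountably many test functions on P(X); it is fixed on X^N,
    where separability gives a countable base of boxes, before any test function is chosen. Only
    frequencies of events enter there, so second moments and pairwise independence suffice.

    Two obstacles shape the identification of [alpha]. [charge_int] rests on a Hahn decomposition
    that is not explicit; as F_{N,N}(lambda) is a finite signed sum of Dirac masses, negative parts
    are moved across the equation and only positive measures are integrated. The integral over
    [Pr_frac] runs over a set whose measurability is not established; the constant function 1 shows
    that it has inner measure one, so the integral extends to P(X).

    Test functions on X^N need not be multiplicative, but Newton's identities are linear relations
    between monomials, hence hold for every permutation-invariant function on words. *)

Definition sym_fun (V : Type) (T : eqType) (psi : seq T -> V) :=
  forall s t, perm_eq s t -> psi s = psi t.

Definition add_block b psi : seq I -> R :=
  fun z => \sum_a psi (nseq b a ++ z).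

Fixpoint powersum psi p : R :=
  if p is b :: p' then powersum (add_block b psi) p' else psi [::].

Definition elem_sym psi n : R := \sum_(S : {set I} | #|S| == n) psi (enum S).

(** For [b >= 2], the image under [psi] of the monomial symmetric function of the hook partition (b,
    1^m); for [b = 1] every monomial is counted [m.+1] times. *)
Definition hook psi b m : R :=
  \sum_(S : {set I} | #|S| == m) \sum_(a | a \notin S) psi (nseq b a ++ enum S).

Lemma sym_add_block b psi : sym_fun psi -> sym_fun (add_block b psi).
Proof. by move=> sp s t st; apply: eq_bigr => a _; apply: sp; rewrite perm_cat2l. Qed.

Lemma sum_set_elem m (F : I -> {set I} -> R) :
  \sum_(S : {set I} | #|S| == m.+1) \sum_(a in S) F a (S :\ a) =
  \sum_(S : {set I} | #|S| == m) \sum_(a | a \notin S) F a S.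
Proof.
rewrite (exchange_big_dep xpredT)//= [RHS](exchange_big_dep xpredT)//=.
apply: eq_bigr => a _.
rewrite (reindex_onto (fun S => a |: S) (fun S => S :\ a))/=; last first.
  by move=> S /andP[_]; exact: finset.setD1K.
apply: eq_big => [S|S /andP[_ /eqP->]]//.
rewrite finset.setU11 andbT; have [aS|aS] := boolP (a \in S).
  rewrite andbF; apply/negbTE/negP => /andP[_ /eqP/setP/(_ a)].
  by rewrite !inE eqxx aS.
by rewrite cardsU1 aS finset.setU1K// eqxx !andbT.
Qed.

Lemma perm_enum_setD1 S a : a \in S -> perm_eq (enum S) (a :: enum (S :\ a)).
Proof.
move=> aS; apply: uniq_perm; rewrite ?enum_uniq//=.
  by rewrite mem_enum !inE eqxx enum_uniq.
move=> x; rewrite inE !mem_enum !inE.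
by case: eqVneq => [->|].
Qed.

Lemma hook1 psi m : sym_fun psi -> hook psi 1 m = m.+1%:R * elem_sym psi m.+1.
Proof.
move=> sp; rewrite /hook -(sum_set_elem m (fun a S => psi (nseq 1 a ++ enum S))).
rewrite mulr_sumr; apply: eq_bigr => S /eqP cS.
rewrite -cS mulr_natl -sumr_const; apply: eq_bigr => a aS.
by apply: sp; rewrite perm_sym perm_enum_setD1.
Qed.

Lemma elem_sym_add_block0 b psi : elem_sym (add_block b psi) 0 = hook psi b 0.
Proof.
apply: eq_bigr => S; rewrite cards_eq0 => /eqP->.
by apply: eq_bigl => a; rewrite inE.
Qed.

(** In the product of p_b and e_{m+1} the letter [a] of the power sum either avoids [S] or belongs
    to it; in the second case it merges into the block, which grows to [b.+1]. *)
Lemma elem_sym_add_blockS b psi m : sym_fun psi ->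
  elem_sym (add_block b psi) m.+1 = hook psi b m.+1 + hook psi b.+1 m.
Proof.
move=> sp; rewrite /hook -(sum_set_elem m (fun a S => psi (nseq b.+1 a ++ enum S))).
rewrite -big_split; apply: eq_bigr => S _.
rewrite /add_block (bigID (mem S))/= addrC; congr +%R.
apply: eq_bigr => a aS; apply: sp.
rewrite (perm_catl _ (perm_enum_setD1 aS)) -cat_rcons perm_sym.
by rewrite -cat_cons perm_cat2r perm_sym perm_rcons.
Qed.

(** Solving [elem_sym_add_blockS] for [hook psi b m.+1] lengthens the block and shortens the rest;
    iterating gives an alternating sum that stops at [m = 0]. *)
Lemma hookE psi b m : sym_fun psi ->
  hook psi b m = \sum_(i < m.+1) (-1) ^+ i * elem_sym (add_block (b + i) psi) (m - i).
Proof.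
move=> sp; elim: m b => [|m IH] b.
  by rewrite big_ord1 expr0 mul1r addn0 elem_sym_add_block0.
rewrite big_ord_recl expr0 mul1r addn0 subn0 elem_sym_add_blockS// IH.
rewrite -addrA -big_split/= big1 ?addr0// => i _.
by rewrite /bump/= add1n subSS exprS addnS addSn mulN1r mulNr subrr.
Qed.

Lemma newton psi n : sym_fun psi ->
  n.+1%:R * elem_sym psi n.+1 =
  \sum_(i < n.+1) (-1) ^+ i * elem_sym (add_block i.+1 psi) (n - i).
Proof. by move=> sp; rewrite -hook1// hookE. Qed.

Lemma powersum_swap psi s b t : sym_fun psi ->
  powersum psi (s ++ b :: t) = powersum psi (b :: s ++ t).
Proof.
elim: s psi => //= c s IH psi sp; rewrite IH; last exact: sym_add_block.
rewrite /=; have -> // : add_block b (add_block c psi) = add_block c (add_block b psi).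
apply/funext => z; rewrite /add_block exchange_big; apply: eq_bigr => i _.
by apply: eq_bigr => j _; apply: sp; rewrite perm_catCA.
Qed.

Lemma powersum_rem psi b p : sym_fun psi -> b \in p ->
  powersum psi p = powersum (add_block b psi) (rem b p).
Proof.
move=> sp bp; rewrite remE -[RHS]/(powersum psi (b :: _)) -powersum_swap//.
by rewrite -[X in X :: drop _ _](nth_index 0%N bp) -drop_nth ?index_mem// cat_take_drop.
Qed.

(* The sign of a permutation of cycle type [p] divided by the order of its
   centralizer. *)
Definition cycle_weight p : R :=
  (-1) ^+ (sumn p - size p) * \prod_(q <- p) (q%:R)^-1
  * \prod_(q <- undup p) ((count_mem q p)`!%:R)^-1.

Lemma perm_undup_rem b p : b \in p ->
  perm_eq (undup p) (b :: [seq q <- undup p | q != b]).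
Proof.
move=> bp; rewrite -rem_filter ?undup_uniq//.
by apply: perm_to_rem; rewrite mem_undup.
Qed.

Lemma sumn_ge_size p : all (leq 1) p -> (size p <= sumn p)%N.
Proof. by elim: p => //= q p IH /andP[q1 /IH]; lia. Qed.

Lemma perm_sumn p p' : perm_eq p p' -> sumn p = sumn p'.
Proof. by move=> pp'; rewrite !sumnE; exact: perm_big. Qed.

(** A permutation with m_q cycles of each length q has a centralizer of order prod_q q^{m_q} m_q!.
    Dropping a cycle of length b divides this by b m_b and changes the sign by (-1)^{b-1}. *)
Lemma cycle_weight_rem b p : all (leq 1) p -> b \in p ->
  b%:R * (count_mem b p)%:R * cycle_weight p = (-1) ^+ b.-1 * cycle_weight (rem b p).
Proof.
move=> p1 bp; have b1 := allP p1 b bp.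
have pp := perm_to_rem bp.
have r1 : all (leq 1) (rem b p) by move: p1; rewrite (perm_all _ pp) => /andP[].
rewrite /cycle_weight (perm_sumn pp) (perm_size pp) (perm_big _ pp)/=.
rewrite big_cons (perm_big _ (perm_undup_rem bp)) big_cons/=.
have -> : (b + sumn (rem b p) - (size (rem b p)).+1 =
  b.-1 + (sumn (rem b p) - size (rem b p)))%N.
  by move: b1 (sumn_ge_size r1) => /=; move: (sumn _) (size _) => u v; lia.
have [c cE] : exists c, count_mem b p = c.+1.
  by exists (count_mem b p).-1; rewrite prednK// -has_count has_pred1.
have count_rem : count_mem b (rem b p) = c.
  by apply: succn_inj; rewrite -cE (seq.permP pp)/= eqxx.
rewrite exprD cE.
(* Only the factor of [b] changes, from the factorial of [c.+1] to that of [c]; if [b] disappears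
   from the list, then [c = 0] and the factor is 1. *)
have -> : \prod_(q <- undup (rem b p)) ((count_mem q (rem b p))`!%:R)^-1 =
    (c`!%:R)^-1 * \prod_(q <- [seq q <- undup p | q != b]) ((count_mem q p)`!%:R)^-1 :> R.
  have E : \prod_(q <- [seq q <- undup p | q != b]) ((count_mem q p)`!%:R)^-1 =
       \prod_(q <- [seq q <- undup p | q != b]) ((count_mem q (rem b p))`!%:R)^-1 :> R.
    apply: eq_big_seq => q; rewrite mem_filter => /andP[qb _].
    by rewrite (seq.permP pp)/= eq_sym (negbTE qb).
  rewrite E; have [bp'|bp'] := boolP (b \in rem b p).
    rewrite (perm_big _ (perm_undup_rem bp')) big_cons count_rem; congr *%R.
    apply: perm_big; apply: uniq_perm; rewrite ?filter_uniq ?undup_uniq//.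
    move=> q; rewrite !mem_filter !mem_undup (perm_mem pp) inE.
    by case: eqVneq.
  move: (bp'); rewrite -has_pred1 has_count -leqNgt count_rem leqn0 => /eqP->.
  rewrite fact0 invr1 mul1r; apply: perm_big; apply: uniq_perm; rewrite ?filter_uniq ?undup_uniq//.
  move=> q; rewrite !mem_filter !mem_undup (perm_mem pp) inE.
  by case: eqVneq => [->|]; first exact/negbTE.
have b0 : b%:R != 0 :> R by rewrite pnatr_eq0; lia.
have c0 : c.+1%:R != 0 :> R by rewrite pnatr_eq0.
rewrite factS natrM invfM.
move: c.+1%:R c0 => v c0; move: (c`!%:R^-1) => f; field.
by rewrite b0 c0.
Qed.

Lemma sumn_undup p : sumn p = (\sum_(q <- undup p) q * count_mem q p)%N.
Proof.
rewrite sumnE -big_undup_iterop_count/=; apply: eq_bigr => q _.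
by case: (count_mem q p) => [|c]; rewrite ?muln0// iteropS iter_addn mulnS addnC.
Qed.

(** Deleting one copy of [b] is a bijection: its inverse inserts [b] and sorts, and a decreasing
    list is determined by its multiset. *)
Lemma sum_partitions_rem n b (G : seq nat -> R) : (0 < b <= n)%N ->
  \sum_(p <- partitions n | b \in p) G (rem b p) = \sum_(p <- partitions (n - b)) G p.
Proof.
move=> bn; rewrite -big_filter -(big_map (rem b) xpredT G).
have geqT : transitive geq by move=> x y z /= yx zx; exact: leq_trans zx yx.
have geqA : antisymmetric geq by move=> x y; rewrite andbC => /anti_leq.
apply: perm_big; apply: uniq_perm; last first.
- move=> p; apply/mapP/idP => [[q + ->]|].
    rewrite mem_filter !mem_partitions => /andP[bq /and3P[sq q1 /eqP qn]].
    have pq := perm_to_rem bq.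
    rewrite /is_partition (subseq_sorted _ (rem_subseq _ _))//=.
    have := q1; rewrite (perm_all _ pq) => /andP[_ r1]; apply/andP; split=> //.
    by rewrite -qn (perm_sumn pq)/= addKn.
  rewrite mem_partitions => /and3P[sp p1 /eqP pn].
  have P := perm_sort geq (b :: p).
  exists (sort geq (b :: p)).
    rewrite mem_filter mem_partitions mem_sort mem_head /is_partition.
    rewrite sort_sorted/=; last by move=> x y; exact: leq_total.
    rewrite (perm_all _ (permEl P)) (perm_sumn (permEl P))/= p1 pn.
    by case/andP: bn => -> ?; rewrite subnKC /=.
  apply: (sorted_eq geqT geqA) => //.
    apply: (subseq_sorted geqT (rem_subseq _ _)).
    by apply: sort_sorted => x y; exact: leq_total.
  rewrite -(perm_cons b) perm_sym.
  apply: perm_trans (permEl P); rewrite perm_sym.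
  by apply: perm_to_rem; rewrite mem_sort mem_head.
- exact: partitions_uniq.
- rewrite map_inj_in_uniq; first by rewrite filter_uniq// partitions_uniq.
  move=> p q; rewrite !(mem_filter _ _ (partitions n)) !mem_partitions.
  move=> /andP[bp /and3P[sp _ _]] /andP[bq /and3P[sq _ _]] pq.
  apply: (sorted_eq geqT geqA) => //.
  apply: perm_trans (perm_to_rem bp) _; rewrite pq perm_sym.
  exact: perm_to_rem.
Qed.

Lemma perm_partitions0 : perm_eq (partitions 0) [:: [::]].
Proof.
apply: uniq_perm; rewrite ?partitions_uniq// => p.
rewrite mem_partitions inE; apply/idP/eqP => [/and3P[_ p1 /eqP p0]|->//].
by apply: size0nil; have := sumn_ge_size p1; rewrite p0 leqn0 => /eqP.
Qed.

Theorem elem_sym_powersum psi n : sym_fun psi ->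
  elem_sym psi n = \sum_(p <- partitions n) cycle_weight p * powersum psi p.
Proof.
have [k] := ubnP n; elim: k n psi => // k IH [|n] psi nk sp.
  rewrite /elem_sym (big_pred1 finset.set0) => [|S]; last by rewrite cards_eq0.
  rewrite (perm_big [:: [::]]) ?perm_partitions0//= big_seq1 /cycle_weight.
  rewrite !big_nil/= !mulr1 expr0 mul1r.
  by have /size0nil-> : size (enum (finset.set0 : {set I})) = 0%N by rewrite -cardE cards0.
rewrite ltnS in nk.
apply: (@mulfI _ n.+1%:R); first by rewrite pnatr_eq0.
rewrite newton// mulr_sumr.
transitivity (\sum_(p <- partitions n.+1) \sum_(i < n.+1 | i.+1 \in p)
   (-1) ^+ i * (cycle_weight (rem i.+1 p) * powersum (add_block i.+1 psi) (rem i.+1 p))).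
  rewrite (exchange_big_dep xpredT)//=; apply: eq_bigr => i _.
  have := ltn_ord i => ilt.
  rewrite (sum_partitions_rem (fun p => (-1) ^+ i *
    (cycle_weight p * powersum (add_block i.+1 psi) p))) ?subSS; last by lia.
  by rewrite -mulr_sumr IH//; [lia|exact: sym_add_block].
apply: eq_big_seq => p; rewrite mem_partitions => /and3P[_ p1 /eqP pn].
(* Newton's identity yields one term per distinct part size, so [n.+1] is spread over these sizes as
   size times multiplicity, the factor that [cycle_weight_rem] absorbs. *)
have -> : n.+1%:R = \sum_(i < n.+1 | i.+1 \in p) i.+1%:R * (count_mem i.+1 p)%:R :> R.
  rewrite -[in LHS]pn sumn_undup natr_sum.
  transitivity (\sum_(1 <= q < n.+2 | q \in p) q%:R * (count_mem q p)%:R : R).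
    rewrite -[RHS]big_filter; rewrite (perm_big [seq q <- index_iota 1 n.+2 | q \in p]).
      by apply: eq_bigr => q _; rewrite natrM.
    apply: uniq_perm; rewrite ?undup_uniq ?filter_uniq ?iota_uniq//.
    move=> q; rewrite mem_undup mem_filter; case: (boolP (q \in p)) => //= qp.
    rewrite mem_index_iota (allP p1 _ qp)/= ltnS -pn sumnE (big_rem q)//=.
    by rewrite leq_addr.
  by rewrite big_add1/= big_mkord.
rewrite mulr_suml; apply: eq_bigr => i ip.
rewrite (powersum_rem sp ip) [LHS]mulrA [RHS]mulrA; congr (_ * _).
by rewrite cycle_weight_rem.
Qed.

End newton.

(** The cycle type on [n] letters with cycles of lengths [p_i + 1] and all other letters fixed;
    [sumn p] is then the least number of transpositions in a factorization. *)
Definition cycle_type n p : seq nat :=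
  map succn p ++ nseq (n - sumn p - size p) 1%N.

Lemma all_gt1_cycle_type p : all (leq 1) p -> all [pred q | q != 1%N] (map succn p).
Proof. by rewrite all_map; apply: sub_all => -[]. Qed.

Lemma sumn_cycle_type n p : (sumn p + size p <= n)%N -> sumn (cycle_type n p) = n.
Proof.
have E : sumn (map succn p) = (sumn p + size p)%N by elim: p => //= q p ->; lia.
by rewrite /cycle_type sumn_cat sumn_nseq E; lia.
Qed.

Lemma size_cycle_type n p : (sumn p + size p <= n)%N ->
  size (cycle_type n p) = (n - sumn p)%N.
Proof. by rewrite /cycle_type size_cat size_map size_nseq; lia. Qed.

(** The factorial in the denominator of [dcoef] is the centralizer factor of the fixed points, and
    (-1)^j is the sign, since j is n minus the number of cycles. *)
Lemma dcoefE (R : realType) n p : all (leq 1) p -> (sumn p + size p <= n)%N ->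
  (-1) ^+ sumn p * dcoef R n p = n`!%:R * cycle_weight R (cycle_type n p).
Proof.
move=> p1 pn; rewrite /cycle_weight sumn_cycle_type// size_cycle_type// subKn; last by lia.
rewrite {2}/cycle_type big_cat/= big_map.
rewrite [X in _ = _ * (_ * (_ * X) * _)]big1_seq ?mulr1; last first.
  by move=> q /andP[_ /nseqP[-> _]]; rewrite invr1.
rewrite /dcoef; set m := (n - sumn p - size p)%N.
suff -> : \prod_(q <- undup (cycle_type n p)) (count_mem q (cycle_type n p))`!%:R^-1 =
    (m`!%:R)^-1 * \prod_(q <- undup p) (count_mem q p)`!%:R^-1 :> R by ring.
rewrite /cycle_type undup_cat big_cat/= mulrC -/m; congr (_ * _).
  have c1 : count_mem 1%N (map succn p ++ nseq m 1%N) = m.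
    rewrite count_cat count_nseq/= mul1n [X in (X + _)%N](_ : _ = 0%N)//.
    by apply/count_memPn; apply/negP => /(allP (all_gt1_cycle_type p1)).
  have [m0|m0] := posnP m; first by rewrite m0/= big_nil fact0 invr1.
  have -> : undup (nseq m 1%N) = [:: 1%N].
    by case: (m) m0 => // k _; elim: k => //= k; rewrite inE eqxx.
  by rewrite big_seq1 c1.
have -> : [seq x <- undup (map succn p) | x \notin nseq m 1%N] = map succn (undup p).
  rewrite (undup_map_inj succn_inj) (all_filterP _)// all_map.
  apply/allP => q; rewrite mem_undup => /(allP p1) q1 /=.
  by apply/nseqP => -[[q0]]; rewrite q0 in q1.
rewrite big_map; apply: eq_big_seq => q; rewrite mem_undup => /(allP p1) q1.
rewrite count_cat count_map count_nseq/= [(_ == _)](_ : _ = false) ?mul0n ?addn0.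
  by rewrite (eq_count (a2 := pred1 q)).
by rewrite eqSS; case: q q1.
Qed.

Lemma sorted_cycle_type n p : sorted geq p -> sorted geq (cycle_type n p).
Proof.
have geqT : transitive geq by move=> x y z /= yx zx; exact: leq_trans zx yx.
rewrite !sorted_pairwise// => sp; rewrite pairwise_cat; apply/and3P; split.
- by apply/allrelP => a b /mapP[a' _ ->] /nseqP[-> _].
- by rewrite pairwise_map.
- by elim: (n - _ - _)%N => //= k ->; rewrite andbT; apply/allP => a /nseqP[->].
Qed.

Definition cycle_type_inv (s : seq nat) := [seq q.-1 | q <- s & q != 1%N].

Lemma cycle_typeK n p : all (leq 1) p -> cycle_type_inv (cycle_type n p) = p.
Proof.
move=> p1; rewrite /cycle_type_inv filter_cat (all_filterP (all_gt1_cycle_type p1)).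
rewrite (_ : seq.filter _ (nseq _ _) = [::]) ?cats0; last by elim: (n - _ - _)%N.
by rewrite -map_comp map_id_in.
Qed.

(** Partitions of [n] are grouped by [j], which is [n] minus the number of parts, and each part is
    lowered by one, so that parts 1 vanish. As [n > 0] there is at least one part, whence [j < n];
    the bound on [j + size p] leaves room to restore the ones. *)
Lemma sum_partitions_cycle_type (V : nmodType) n (G : seq nat -> V) : (0 < n)%N ->
  \sum_(p <- partitions n) G p =
  \sum_(j < n) \sum_(p <- partitions j | (j + size p <= n)%N) G (cycle_type n p).
Proof.
move=> n0; transitivity (\sum_(j < n) \sum_(p <- partitions n | (n - size p == j)%N) G p).
  rewrite (exchange_big_dep xpredT)//=; apply: eq_big_seq => p.
  rewrite mem_partitions => /and3P[_ p1 /eqP pn].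
  have p0 : (n - size p < n)%N.
    by case: p pn {p1} => /= [|a p]; lia.
  by rewrite (big_pred1 (Ordinal p0))// => j; rewrite -val_eqE/= eq_sym.
apply: eq_bigr => j _; rewrite -big_filter -[RHS]big_filter -(big_map (cycle_type n) xpredT G).
have geqT : transitive geq by move=> x y z /= yx zx; exact: leq_trans zx yx.
have geqA : antisymmetric geq by move=> x y; rewrite andbC => /anti_leq.
have jn := ltn_ord j.
apply: perm_big; apply: uniq_perm.
- by rewrite filter_uniq// partitions_uniq.
- rewrite map_inj_in_uniq; first by rewrite filter_uniq// partitions_uniq.
  move=> p q; rewrite !(mem_filter _ _ (partitions j)) !mem_partitions.
  move=> /andP[_ /and3P[_ p1 _]] /andP[_ /and3P[_ q1 _]].
  by move=> /(congr1 cycle_type_inv); rewrite !cycle_typeK.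
move=> s; rewrite mem_filter mem_partitions; apply/idP/mapP; last first.
  move=> [p + ->]; rewrite mem_filter mem_partitions => /andP[pn /and3P[sp p1 /eqP pj]].
  have pn' : (sumn p + size p <= n)%N by rewrite pj.
  rewrite size_cycle_type// subKn ?pj 1?ltnW// eqxx/=.
  rewrite /is_partition sumn_cycle_type// eqxx andbT; apply/andP; split; last first.
    by rewrite all_cat all_map all_nseq orbT andbT; apply/allP => -[].
  exact: sorted_cycle_type.
(* Surjectivity: [s] is recovered from its parts above 1, because the number of ones is forced by
   the sum and both lists are decreasing. *)
move=> /andP[/eqP nj /and3P[ss s1 /eqP sn]].
set m := count_mem 1%N s.
have E : cycle_type n (cycle_type_inv s) =
    [seq q <- s | q != 1%N] ++ nseq (n - sumn (cycle_type_inv s) - size (cycle_type_inv s)) 1%N.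
  rewrite /cycle_type -map_comp; congr (_ ++ _); rewrite map_id_in// => q.
  by rewrite mem_filter => /andP[_ /(allP s1)] /=; lia.
have P : perm_eq s ([seq q <- s | q != 1%N] ++ nseq m 1%N).
  rewrite -(perm_filterC [pred q | q != 1%N] s) perm_cat2l.
  have -> : seq.filter (predC [pred q | q != 1%N]) s = seq.filter (pred1 1%N) s.
    by apply: eq_filter => q /=; rewrite negbK.
  by have /all_pred1P := filter_all (pred1 1%N) s; rewrite size_filter => ->.
have sumcore : sumn s = (sumn (cycle_type_inv s) + size (cycle_type_inv s) + m)%N.
  rewrite (perm_sumn P) sumn_cat sumn_nseq mul1n; congr addn.
  rewrite /cycle_type_inv size_map; elim: (s) s1 => //= q s' IH /andP[q1 /IH].
  by case: eqVneq => //= _ ->; move: q1 => /=; lia.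
have sizecore : size s = (size (cycle_type_inv s) + m)%N.
  by rewrite (perm_size P) size_cat size_nseq size_map.
have sc : sorted geq (cycle_type_inv s).
  apply: (homo_sorted (e := geq)) => [x y /=|]; first by lia.
  exact: sorted_filter.
have Es : s = cycle_type n (cycle_type_inv s).
  apply: (sorted_eq geqT geqA) => //; last first.
    by rewrite E; apply: perm_trans P _; rewrite -sn sumcore -subnDA addnC addnK.
  by exact: sorted_cycle_type.
exists (cycle_type_inv s) => //.
rewrite mem_filter mem_partitions /is_partition sc.
have scj : sumn (cycle_type_inv s) = j by rewrite -nj -sn sumcore sizecore -addnA addnK.
rewrite scj eqxx andbT; apply/andP; split.
  by apply: leq_trans (eq_leq sn); rewrite sumcore scj leq_addr.
apply/andP; split=> //.
by apply/allP => q /mapP[r]; rewrite mem_filter => /andP[/= r1 /(allP s1)/=] ? ->; lia.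
Qed.

(** Only the full set has maximal size, so e_N in N letters is a single monomial; this is why
    F_{N,N} returns the value at the tuple itself. *)
Lemma elem_sym_card (R : numFieldType) (I : finType) (psi : seq I -> R) :
  elem_sym psi #|I| = psi (enum I).
Proof.
rewrite /elem_sym (big_pred1 (finset.setTfor I)) => [|S]; first by rewrite enum_setT enumT.
by rewrite -(cardsT I) [RHS]eqEcard finset.subsetT eqn_leq subset_leq_card.
Qed.

Lemma sum_dcoef_powersum (R : realType) (I : finType) (psi : seq I -> R) :
  sym_fun psi -> (0 < #|I|)%N ->
  \sum_(j < #|I|) (-1) ^+ j * (\sum_(p <- partitions j | (j + size p <= #|I|)%N)
     dcoef R #|I| p * powersum psi (cycle_type #|I| p)) =
  (#|I|)`!%:R * psi (enum I).
Proof.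
move=> sp n0; rewrite -elem_sym_card elem_sym_powersum// sum_partitions_cycle_type//.
rewrite mulr_sumr; apply: eq_bigr => j _; rewrite !mulr_sumr.
rewrite big_seq_cond [RHS]big_seq_cond; apply: eq_bigr => p.
rewrite mem_partitions => /andP[/and3P[_ p1 /eqP pj] pn].
by rewrite [LHS]mulrA [RHS]mulrA -dcoefE ?pj.
Qed.

(** * Finite combinations of Dirac masses *)

Section atomic.
Context d (T : measurableType d) (R : realType).
Implicit Types (s : seq (R * T)) (f : T -> R).

Definition wsum s f : R := \sum_(u <- s) u.1 * f u.2.

Definition atomic (nu : set T -> \bar R) s :=
  forall A, measurable A -> nu A = (wsum s \1_A)%:E.

Definition bounded f := exists M, forall x, `|f x| <= M.

Lemma bounded_integrable (m : {finite_measure set T -> \bar R}) f :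
  measurable_fun setT f -> bounded f -> m.-integrable setT (EFin \o f).
Proof.
move=> mf [M fM]; apply: measurable_bounded_integrable => //.
  by rewrite -ge0_fin_numE ?fin_num_measure.
exists M; split; first exact: num_real.
by move=> N MN x _; exact: le_trans (fM x) (ltW MN).
Qed.

Lemma Rintegral_measure_add (m1 m2 m : {finite_measure set T -> \bar R}) f :
  (forall A, measurable A -> m A = (m1 A + m2 A)%E) ->
  measurable_fun setT f -> bounded f ->
  \int[m]_x f x = \int[m1]_x f x + \int[m2]_x f x.
Proof.
move=> mE mf bf; have i1 := bounded_integrable m1 mf bf.
have i2 := bounded_integrable m2 mf bf.
rewrite /Rintegral -fineD; last 2 first.
  exact: integrable_fin_num.
  exact: integrable_fin_num.
rewrite -integral_measure_add//.
congr fine; apply: eq_measure_integral => A mA _ /=.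
by rewrite mE// /measure_add/= /msum/= !big_ord_recl big_ord0/= adde0.
Qed.

Lemma eq_Rintegral_measure (m1 m2 : {measure set T -> \bar R}) f :
  meas_eq m1 m2 -> \int[m1]_x f x = \int[m2]_x f x.
Proof. by move=> m12; congr fine; apply: eq_measure_integral => A mA _; exact: m12. Qed.

Definition finadd (m1 m2 : {finite_measure set T -> \bar R}) := measure_add m1 m2.

HB.instance Definition _ m1 m2 := Measure.on (finadd m1 m2).

Lemma finaddE m1 m2 A : finadd m1 m2 A = (m1 A + m2 A)%E.
Proof. by rewrite /finadd/= /measure_add/= /msum/= !big_ord_recl big_ord0/= adde0. Qed.

Let finadd_fin m1 m2 : fin_num_fun (finadd m1 m2).
Proof. by move=> A mA; rewrite finaddE fin_numD !fin_num_measure. Qed.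

HB.instance Definition _ m1 m2 := @Measure_isFinite.Build _ _ _ (finadd m1 m2) (@finadd_fin m1 m2).

Definition absdirac (c : R) (x : T) : {finite_measure set T -> \bar R} :=
  mscale `|c|%:nng (dirac x).

Lemma absdiracE c x A : absdirac c x A = (`|c| * \1_A x)%:E.
Proof. by []. Qed.

Lemma Rintegral_absdirac c x f : measurable_fun setT f -> bounded f ->
  \int[absdirac c x]_y f y = `|c| * f x.
Proof.
move=> mf bf; have mEf : measurable_fun setT (EFin \o f) by exact/measurable_EFinP.
rewrite /Rintegral integralE !ge0_integral_mscale//; last 2 first.
  exact: measurable_funeneg.
  exact: measurable_funepos.
rewrite !integral_dirac//; last 2 first.
  exact: measurable_funeneg.
  exact: measurable_funepos.
rewrite diracT !mul1e -muleBr//; last exact: add_def_funeposneg.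
by have /= <- := congr1 (@^~ x) (funeposneg (EFin \o f)).
Qed.

(** Weights enter by absolute value so that the result is a measure; it serves for the atoms of
    nonnegative and of negative weight separately. *)
Fixpoint dirac_sum s : {finite_measure set T -> \bar R} :=
  if s is u :: s' then finadd (absdirac u.1 u.2) (dirac_sum s') else absdirac 0 point.

Lemma dirac_sumE s A : dirac_sum s A = (\sum_(u <- s) `|u.1| * \1_A u.2)%:E.
Proof.
elim: s => [|u s IH]; first by rewrite big_nil /= absdiracE normr0 mul0r.
by rewrite big_cons /= finaddE IH absdiracE -EFinD.
Qed.

Lemma Rintegral_dirac_sum s f : measurable_fun setT f -> bounded f ->
  \int[dirac_sum s]_x f x = \sum_(u <- s) `|u.1| * f u.2.
Proof.
move=> mf bf; elim: s => [|u s IH].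
  by rewrite big_nil /= Rintegral_absdirac// normr0 mul0r.
rewrite big_cons /= (Rintegral_measure_add (m1 := absdirac u.1 u.2) (m2 := dirac_sum s))//.
  by rewrite IH Rintegral_absdirac.
by move=> A mA; exact: finaddE.
Qed.

Lemma wsum_pos_neg s f : wsum s f =
  \sum_(u <- [seq u <- s | 0 <= u.1]) `|u.1| * f u.2 -
  \sum_(u <- [seq u <- s | ~~ (0 <= u.1)]) `|u.1| * f u.2.
Proof.
rewrite !big_filter /wsum (bigID (fun u => 0 <= u.1))/= -sumrN; congr +%R.
  by apply: eq_bigr => u u0; rewrite ger0_norm.
by apply: eq_bigr => u; rewrite -ltNge => u0; rewrite ltr0_norm// mulNr opprK.
Qed.

(** Weights may be negative although [m] is a measure; adding the negative atoms to both sides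
    leaves an identity between finite measures. *)
Lemma Rintegral_atomic (m : {finite_measure set T -> \bar R}) s f : atomic m s ->
  measurable_fun setT f -> bounded f -> \int[m]_x f x = wsum s f.
Proof.
move=> ms mf bf; rewrite wsum_pos_neg -!Rintegral_dirac_sum//.
set pos := [seq u <- s | _]; set neg := [seq u <- s | ~~ _].
apply/eqP; rewrite eq_sym subr_eq eq_sym; apply/eqP.
rewrite -(@Rintegral_measure_add _ _ (finadd m (dirac_sum neg)))//; last first.
  by move=> A mA; exact: finaddE.
apply: eq_Rintegral_measure => A mA; apply: etrans (finaddE _ _ _) _.
rewrite ms// !dirac_sumE wsum_pos_neg -/pos -/neg -EFinD subrK.
by apply: etrans (esym (dirac_sumE _ _)).
Qed.

(** Atoms may cancel, so the Jordan parts need not be the sums over positive and negative weights.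
    Both pairs have the same difference, so [jp] plus the negative atoms equals [jn] plus the
    positive ones. *)
Lemma charge_int_atomic (nu : {charge set T -> \bar R}) s f : atomic nu s ->
  measurable_fun setT f -> bounded f -> charge_int nu f = wsum s f.
Proof.
move=> nus mf bf; rewrite /charge_int wsum_pos_neg.
set pos := [seq u <- s | _]; set neg := [seq u <- s | ~~ _].
set jp := jordan_pos _; set jn := jordan_neg _.
apply/eqP; rewrite subr_eq addrAC eq_sym subr_eq; apply/eqP.
rewrite -!Rintegral_dirac_sum//.
rewrite -(@Rintegral_measure_add _ _ (finadd (dirac_sum pos) jn))//; last first.
  by move=> A mA; exact: finaddE.
rewrite -(@Rintegral_measure_add _ _ (finadd jp (dirac_sum neg)))//; last first.
  by move=> A mA; exact: finaddE.
apply: eq_Rintegral_measure => A mA.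
have := jordan_decomp (hahn_posneg nu) mA.
rewrite nus// wsum_pos_neg -/pos -/neg /cadd/= cscaleN1 => E.
apply: etrans (finaddE _ _ _) _; apply: etrans (esym (finaddE _ _ _)).
rewrite !dirac_sumE.
have [a ja] : exists a, jp A = a%:E.
  by exists (fine (jp A)); rewrite fineK//; exact: (fin_num_measure (jordan_pos _)).
have [b jb] : exists b, jn A = b%:E.
  by exists (fine (jn A)); rewrite fineK//; exact: (fin_num_measure (jordan_neg _)).
have {E} : _ = (jp A - jn A)%E := E; rewrite ja jb -EFinB => -[E].
set p := \sum_(u <- pos) _ in E *; set n := \sum_(u <- neg) _ in E *.
transitivity (p%:E + b%:E)%E; first by rewrite -jb.
transitivity (a%:E + n%:E)%E; last by rewrite -ja.
by rewrite -!EFinD; congr EFin; lra.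
Qed.

Lemma wsum_cat s s' f : wsum (s ++ s') f = wsum s f + wsum s' f.
Proof. exact: big_cat. Qed.

Definition scale_atoms (c : R) s := [seq (c * u.1, u.2) | u <- s].

Lemma wsum_scale c s f : wsum (scale_atoms c s) f = c * wsum s f.
Proof. by rewrite /wsum big_map mulr_sumr; apply: eq_bigr => u _; rewrite mulrA. Qed.

Lemma atomic_cscale c (nu : {charge set T -> \bar R}) s :
  atomic nu s -> atomic (cscale c nu) (scale_atoms c s).
Proof. by move=> nus A mA; rewrite /cscale nus// wsum_scale. Qed.

Lemma atomic_cadd (nu nu' : {charge set T -> \bar R}) s s' :
  atomic nu s -> atomic nu' s' -> atomic (cadd nu nu') (s ++ s').
Proof. by move=> nus nus' A mA; rewrite /cadd nus// nus'// wsum_cat. Qed.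

End atomic.

Section push.
Context d (T : measurableType d) d' (T' : measurableType d') (R : realType).

Definition push_atoms (h : T -> T') (s : seq (R * T)) := [seq (u.1, h u.2) | u <- s].

Lemma wsum_push h s (f : T' -> R) : wsum (push_atoms h s) f = wsum s (f \o h).
Proof. by rewrite /wsum big_map. Qed.

Lemma atomic_cpush (h : {mfun T >-> T'}) (nu : {charge set T -> \bar R}) s :
  atomic nu s -> atomic (cpush h nu) (push_atoms h s).
Proof.
move=> nus A mA; rewrite cpushE nus; last first.
  by rewrite -[X in measurable X]setTI; exact: measurable_funPT.
by rewrite wsum_push.
Qed.

Lemma atomic_distribution (h : {mfun T >-> T'}) (m : probability T R) s :
  atomic m s -> atomic (distribution m h) (push_atoms h s).
Proof.
move=> ms A mA; rewrite /distribution/= /pushforward ms; last first.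
  by rewrite -[X in measurable X]setTI; exact: measurable_funPT.
by rewrite wsum_push.
Qed.

Definition prod_atoms (s : seq (R * T)) (s' : seq (R * T')) : seq (R * (T * T')) :=
  [seq (u.1 * v.1, (u.2, v.2)) | u <- s, v <- s'].

Lemma wsum_prod s s' f :
  wsum (prod_atoms s s') f = wsum s (fun x => wsum s' (fun y => f (x, y))).
Proof.
rewrite /wsum big_allpairs_dep/=; apply: eq_bigr => u _; rewrite mulr_sumr.
by apply: eq_bigr => v _; rewrite mulrA.
Qed.

Lemma atomic_product (m : probability T R) (m' : probability T' R) s s' :
  atomic m s -> atomic m' s' -> atomic (m \x m')%E (prod_atoms s s').
Proof.
move=> ms ms' A mA; rewrite wsum_prod.
pose g x := wsum s' (fun y => \1_A (x, y)).
have gE x : m' (xsection A x) = (g x)%:E.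
  rewrite ms'; last exact: measurable_xsection.
  congr EFin; apply: eq_bigr => u _; congr (_ * _).
  by rewrite !indicE mem_xsection.
have mg : measurable_fun setT g.
  apply/measurable_EFinP; rewrite (_ : _ \o _ = m' \o xsection A).
    exact: measurable_fun_xsection.
  by apply/funext => x /=; rewrite gE.
have bg : bounded g.
  exists 1 => x; rewrite -lee_fin ger0_norm -?lee_fin -gE//.
  by apply: probability_le1; exact: measurable_xsection.
transitivity (\int[m]_x (g x)%:E)%E.
  by apply: eq_integral => x _ /=; rewrite gE.
by rewrite -(Rintegral_atomic ms mg bg) fineK//; exact/integrable_fin_num/bounded_integrable.
Qed.

End push.

(** * Atomic measures acting on symmetric functions of words *)

Section powersum_linear.
Context (R : numFieldType) (I : finType).

Lemma powersum_sum (J : finType) (F : J -> seq I -> R) p :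
  powersum (fun z => \sum_j F j z) p = \sum_j powersum (F j) p.
Proof.
elim: p F => //= b p IH F; rewrite -IH; congr powersum.
by apply/funext => z; rewrite /add_block exchange_big.
Qed.

Lemma powersum_cat (psi : seq I -> R) p q :
  powersum (fun u => powersum (fun v => psi (u ++ v)) q) p = powersum psi (p ++ q).
Proof.
elim: p psi => //= b p IH psi; rewrite -IH; congr powersum.
apply/funext => u; rewrite /add_block powersum_sum.
by apply: eq_bigr => a _; congr powersum; apply/funext => v; rewrite catA.
Qed.

Lemma powersumZ (c : R) (psi : seq I -> R) p :
  powersum (fun z => c * psi z) p = c * powersum psi p.
Proof.
elim: p psi => //= b p IH psi; rewrite -IH; congr powersum.
by apply/funext => z; rewrite /add_block mulr_sumr.
Qed.

End powersum_linear.

Section sym_atomic.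
Context d (T : measurableType d) (R : realType).
Implicit Types (g : seq T -> R) (L : (seq T -> R) -> R).

(** [L] acts on functions of words of any length, so that concatenation needs no casts. Testing
    symmetric [g] only makes [symmetrize] and the order of tensor factors invisible. *)
Definition sym_atomic n (nu : set (n.-tuple T) -> \bar R) L :=
  exists2 s, atomic nu s & forall g, sym_fun g -> wsum s (g \o val) = L g.

Lemma sym_atomic_ext n (nu : set (n.-tuple T) -> \bar R) L L' :
  (forall g, sym_fun g -> L g = L' g) -> sym_atomic nu L -> sym_atomic nu L'.
Proof. by move=> LL' [s nus sL]; exists s => // g sg; rewrite sL// LL'. Qed.

Lemma sym_atomic_nil : sym_atomic (\d_([tuple] : 0.-tuple T)) (fun g => g [::]).
Proof.
exists [:: (1, [tuple])] => [A mA|g _]; rewrite /wsum big_seq1/= mul1r//.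
Qed.

Lemma sym_atomic_tensor m n (mu : probability (m.-tuple T) R)
    (nu : probability (n.-tuple T) R) L M :
  sym_atomic mu L -> sym_atomic nu M ->
  sym_atomic (tensor mu nu) (fun g => L (fun u => M (fun v => g (u ++ v)))).
Proof.
move=> [s mus sL] [t nut tM]; exists (push_atoms (@tuple_cat _ T m n) (prod_atoms s t)).
  by apply: atomic_distribution; exact: atomic_product.
move=> g sg; rewrite wsum_push wsum_prod -sL.
  apply: eq_bigr => u _; congr (_ * _); rewrite /= -tM//.
  by move=> v v' vv'; apply: sg; rewrite perm_cat2l.
move=> u u' uu'; congr M; apply/funext => v; apply: sg.
by rewrite perm_cat2r.
Qed.

Lemma sym_atomic_cscale n c (nu : {charge set (n.-tuple T) -> \bar R}) L :
  sym_atomic nu L -> sym_atomic (cscale c nu) (fun g => c * L g).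
Proof.
move=> [s nus sL]; exists (scale_atoms c s); first exact: atomic_cscale.
by move=> g sg; rewrite wsum_scale sL.
Qed.

Lemma sym_atomic_cadd n (nu nu' : {charge set (n.-tuple T) -> \bar R}) L L' :
  sym_atomic nu L -> sym_atomic nu' L' ->
  sym_atomic (cadd nu nu') (fun g => L g + L' g).
Proof.
move=> [s nus sL] [s' nus' sL']; exists (s ++ s'); first exact: atomic_cadd.
by move=> g sg; rewrite wsum_cat sL// sL'.
Qed.

Lemma sym_atomic_csum n (I : eqType) (r : seq I) (P : pred I)
    (nu : I -> {charge set (n.-tuple T) -> \bar R}) (L : I -> (seq T -> R) -> R) :
  (forall i, i \in r -> P i -> sym_atomic (nu i) (L i)) ->
  sym_atomic (csum r P nu) (fun g => \sum_(i <- r | P i) L i g).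
Proof.
elim: r => [|i r IH] nuL.
  exists [::] => [A mA|g sg]; last by rewrite /wsum !big_nil.
  by rewrite csumE /wsum !big_nil.
have [t rt tL] := IH (fun j jr => nuL j (@mem_behead _ (i :: r) j jr)).
have [Pi|NPi] := boolP (P i); last first.
  exists t => [A mA|g sg]; last by rewrite tL// big_cons (negbTE NPi).
  by rewrite csumE big_cons (negbTE NPi) -rt// csumE.
have [s nus sL] := nuL i (mem_head _ _) Pi.
exists (s ++ t) => [A mA|g sg]; rewrite wsum_cat.
  by rewrite csumE big_cons Pi EFinD -nus// -rt// csumE.
by rewrite big_cons Pi sL// tL.
Qed.

Lemma sym_atomic_symmetrize n (nu : {charge set (n.-tuple T) -> \bar R}) L :
  sym_atomic nu L -> sym_atomic (symmetrize nu) L.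
Proof.
move=> nuL; rewrite /symmetrize.
apply: (@sym_atomic_ext _ _ (fun g => n`!%:R^-1 * \sum_(s <- index_enum 'S_n) L g)).
  by move=> g _; rewrite sumr_const card_Sn -[L g *+ _]mulr_natl mulKf//.
apply: sym_atomic_cscale; apply: sym_atomic_csum => p _ _.
have [s nus sL] := nuL.
exists (push_atoms (tuple_perm p) s); first exact: atomic_cpush.
move=> g sg; rewrite wsum_push -sL//; apply: eq_bigr => u _; congr (_ * _).
by apply: sg; apply/tuple_permP; exists p.
Qed.

Lemma sym_atomic_resize m k (mu : probability (m.-tuple T) R) L : m = k ->
  sym_atomic mu L -> sym_atomic (distribution mu (@tuple_resize _ T m k)) L.
Proof.
move=> mk [s mus sL]; exists (push_atoms (@tuple_resize _ T m k) s).
  exact: atomic_distribution.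
move=> g sg; rewrite wsum_push -sL//; apply: eq_bigr => u _; congr (_ * _).
by rewrite -[LHS]/(g (tval (tuple_resize k u.2))) (tuple_resizeE mk) val_tcast.
Qed.

End sym_atomic.

(** * Evaluation of F_{N,N} at an empirical measure *)

Section Fmeas_discrete.
Context d (T : measurableType d) (R : realType) (N : nat) (x : 'I_N -> T).
Variable l : probability T R.
Hypothesis lx : atomic l [seq (N%:R^-1, x i) | i <- index_enum 'I_N].

(** Words run over indices because the points [x i] may coincide, while each index must contribute
    its own mass 1/N. *)
Let psi (g : seq T -> R) (z : seq 'I_N) := g (map x z).

Let sym_psi g : sym_fun g -> sym_fun (psi g).
Proof. by move=> sg s t st; apply: sg; exact: perm_map. Qed.

Lemma sym_atomic_diag n :
  sym_atomic (diag l n) (fun g => N%:R^-1 * \sum_i g (nseq n (x i))).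
Proof.
exists (push_atoms (@tuple_diag _ T n) [seq (N%:R^-1, x i) | i <- index_enum 'I_N]).
  exact: atomic_distribution.
by move=> g _; rewrite wsum_push /wsum big_map mulr_sumr.
Qed.

(** Integrating against [diag l b] averages over one point repeated [b] times, which is
    multiplication by p_b / N. *)
Lemma sym_atomic_tensor_diag b n (nu : probability (n.-tuple T) R) (c : R) p :
  sym_atomic nu (fun g => c * powersum (psi g) p) ->
  sym_atomic (tensor (diag l b) nu)
    (fun g => N%:R^-1 * c * powersum (psi g) (b :: p)).
Proof.
move=> nup; apply: sym_atomic_ext (sym_atomic_tensor (sym_atomic_diag b) nup).
move=> g sg; rewrite -mulrA -mulr_sumr/= -powersum_sum; congr (_ * (_ * powersum _ _)).
apply/funext => z; apply: eq_bigr => i _; rewrite /psi.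
by rewrite map_cat map_nseq.
Qed.

Lemma sym_atomic_power m :
  sym_atomic (power l m) (fun g => N%:R^-1 ^+ m * powersum (psi g) (nseq m 1%N)).
Proof.
elim: m => [|m IH].
  apply: sym_atomic_ext (sym_atomic_nil _ _) => g _.
  by rewrite expr0 mul1r.
apply: sym_atomic_ext (sym_atomic_tensor_diag 1 IH) => g _.
by rewrite exprS.
Qed.

Lemma sym_atomic_blocks p :
  sym_atomic (blocks l p) (fun g => N%:R^-1 ^+ size p * powersum (psi g) (map succn p)).
Proof.
elim: p => [|q p IH].
  apply: sym_atomic_ext (sym_atomic_nil _ _) => g _.
  by rewrite expr0 mul1r.
apply: sym_atomic_ext (sym_atomic_tensor_diag q.+1 IH) => g _.
by rewrite exprS.
Qed.

(** Each block and each single factor brings one 1/N; their number is the number of cycles, k -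
    j. *)
Lemma sym_atomic_partition k p : (sumn p + size p <= k)%N ->
  sym_atomic (partition_measure l k p)
    (fun g => N%:R^-1 ^+ (k - sumn p) * powersum (psi g) (cycle_type k p)).
Proof.
move=> pk; apply: sym_atomic_resize.
  suff -> : sumn [seq q.+1 | q <- p] = (sumn p + size p)%N by lia.
  by elim: (p) => //= q p' ->; lia.
apply: sym_atomic_ext (sym_atomic_tensor (sym_atomic_blocks p) (sym_atomic_power _)).
move=> g sg; rewrite /cycle_type; set m := (k - sumn p - size p)%N.
have -> : (k - sumn p = size p + m)%N by rewrite /m; lia.
rewrite exprD -mulrA; congr (_ * _); rewrite -powersum_cat -powersumZ.
congr powersum; apply/funext => u; rewrite /psi; congr (_ * powersum _ _).
by apply/funext => v; rewrite map_cat.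
Qed.

Lemma sym_atomic_Ppart k j :
  sym_atomic (Ppart k j l)
    (fun g => \sum_(p <- partitions j | (j + size p <= k)%N)
       dcoef R k p * (N%:R^-1 ^+ (k - j) * powersum (psi g) (cycle_type k p))).
Proof.
apply: sym_atomic_csum => p; rewrite mem_partitions => /and3P[_ _ /eqP pj] pk.
apply: sym_atomic_cscale; rewrite -pj; apply: sym_atomic_partition.
by rewrite pj.
Qed.

Lemma prod_falling n : \prod_(1 <= i < n.+1) (n.+1%:R - i%:R) = n`!%:R :> R.
Proof.
rewrite fact_prod natr_prod !big_add1/= !big_mkord (reindex_inj rev_ord_inj).
apply: eq_bigr => i _ /=; have := ltn_ord i => ilt.
by rewrite -natrB; [congr (_%:R); lia|lia].
Qed.

(** The denominator is (n-1)!. In [sym_atomic_Fmeas] the resulting power cancels all the weights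
    1/N. *)
Lemma falling_ratio n : (0 < n)%N ->
  n`!%:R * (n%:R ^+ n.-1 / \prod_(1 <= i < n) (n%:R - i%:R)) = n%:R ^+ n :> R.
Proof.
case: n => // n _; rewrite prod_falling factS natrM exprS/=.
have : n`!%:R != 0 :> R by rewrite pnatr_eq0 -lt0n fact_gt0.
by move=> a0; rewrite mulrACA mulfV// mulr1.
Qed.

Theorem sym_atomic_Fmeas : (0 < N)%N ->
  sym_atomic (Fmeas N N l) (fun g => g (map x (enum 'I_N))).
Proof.
move=> N0.
have FL : sym_atomic (Fmeas N N l) (fun g =>
    N%:R ^+ N.-1 / \prod_(1 <= i < N) (N%:R - i%:R) *
    (N%:R^-1 ^+ N * powersum (psi g) (nseq N 1%N) +
     \sum_(j <- index_iota 1 N) (-1) ^+ j / N%:R ^+ j *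
       \sum_(p <- partitions j | (j + size p <= N)%N)
         dcoef R N p * (N%:R^-1 ^+ (N - j) * powersum (psi g) (cycle_type N p)))).
  apply: sym_atomic_cscale; apply: sym_atomic_cadd; first exact: sym_atomic_power.
  apply: sym_atomic_csum => j _ _; apply: sym_atomic_cscale.
  by apply: sym_atomic_symmetrize; exact: sym_atomic_Ppart.
apply: sym_atomic_ext FL => g sg.
have := sum_dcoef_powersum (sym_psi sg); rewrite card_ord => /(_ N0) E.
have F_neq0 : N`!%:R != 0 :> R by rewrite pnatr_eq0 -lt0n fact_gt0.
have N_neq0 : N%:R != 0 :> R by rewrite pnatr_eq0 -lt0n.
apply: (mulfI F_neq0); rewrite -[RHS]E.
(* The leading product measure is the term [j = 0]: the empty partition, whose cycle type consists
   of N ones. *)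
rewrite -(big_mkord xpredT (fun j => (-1) ^+ j * \sum_(p <- partitions j | (j + size p <= N)%N)
  dcoef R N p * powersum (psi g) (cycle_type N p))) [RHS]big_ltn//.
rewrite mulrA falling_ratio// mulrDr; congr (_ + _).
  rewrite (perm_big _ perm_partitions0) big_cons big_nil/= addr0 expr0 mul1r.
  rewrite mulrA -exprMn mulfV// expr1n mul1r /cycle_type/= !subn0.
  rewrite /dcoef !big_nil !mulr1/= !subn0 mulfV// mul1r//.
rewrite mulr_sumr; apply: eq_big_nat => j /andP[j1 jN].
rewrite -!mulrA mulrCA; congr (_ * _); rewrite !mulr_sumr.
apply: eq_bigr => p _.
have -> : N%:R ^+ N = N%:R ^+ (N - j) * N%:R ^+ j :> R by rewrite -exprD subnK// ltnW.
have a0 : N%:R ^+ j != 0 :> R by rewrite expf_neq0.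
have b0 : N%:R ^+ (N - j) != 0 :> R by rewrite expf_neq0.
rewrite exprVn; field.
by rewrite a0 b0.
Qed.

End Fmeas_discrete.

(** * The law of large numbers for events *)

Section bounded_measurable.
Context d (T : measurableType d) (R : realType).
Implicit Types (f g : T -> R).

Definition bmeas f := measurable_fun setT f /\ bounded f.

Lemma bmeas_cst c : bmeas (cst c).
Proof. by split; [exact: measurable_cst|exists `|c|]. Qed.

Lemma bmeas_indic (A : set T) : measurable A -> bmeas \1_A.
Proof.
move=> mA; split; first exact: measurable_indic.
by exists 1 => x; rewrite indicE normr_nat lern1 leq_b1.
Qed.

Lemma bmeasD f g : bmeas f -> bmeas g -> bmeas (fun x => f x + g x).
Proof.
move=> [mf [M fM]] [mg [K gK]]; split; first exact: measurable_funD.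
by exists (M + K) => x; apply: le_trans (ler_normD _ _) _; exact: lerD.
Qed.

Lemma bmeasM f g : bmeas f -> bmeas g -> bmeas (fun x => f x * g x).
Proof.
move=> [mf [M fM]] [mg [K gK]]; split; first exact: measurable_funM.
by exists (M * K) => x; rewrite normrM ler_pM.
Qed.

Lemma bmeasZ c f : bmeas f -> bmeas (fun x => c * f x).
Proof. exact: bmeasM (bmeas_cst c). Qed.

Lemma bmeas_sum I (r : seq I) (F : I -> T -> R) :
  (forall i, bmeas (F i)) -> bmeas (fun x => \sum_(i <- r) F i x).
Proof.
move=> mF; elim: r => [|i r IH].
  by under eq_fun do rewrite big_nil; exact: bmeas_cst.
by under eq_fun do rewrite big_cons; exact: bmeasD.
Qed.

Variable m : probability T R.

Lemma integrable_bmeas f : bmeas f -> m.-integrable setT (EFin \o f).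
Proof. by case=> mf bf; exact: bounded_integrable. Qed.

Lemma Rintegral_bmeasD f g : bmeas f -> bmeas g ->
  \int[m]_x (f x + g x) = \int[m]_x f x + \int[m]_x g x.
Proof. by move=> bf bg; apply: RintegralD => //; exact: integrable_bmeas. Qed.

Lemma Rintegral_bmeasZ c f : bmeas f -> \int[m]_x (c * f x) = c * \int[m]_x f x.
Proof. by move=> bf; apply: RintegralZl => //; exact: integrable_bmeas. Qed.

Lemma Rintegral_bmeas_sum I (r : seq I) (F : I -> T -> R) :
  (forall i, bmeas (F i)) ->
  \int[m]_x (\sum_(i <- r) F i x) = \sum_(i <- r) \int[m]_x F i x.
Proof.
move=> mF; elim: r => [|i r IH].
  rewrite big_nil; under eq_Rintegral do rewrite big_nil.
  by rewrite Rintegral_cst// mul0r.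
rewrite big_cons -IH -Rintegral_bmeasD//; last exact: bmeas_sum.
by apply: eq_Rintegral => x _; rewrite big_cons.
Qed.

Lemma Rintegral_prob_cst c : \int[m]_x c = c.
Proof.
rewrite Rintegral_cst// -[RHS]mulr1; congr (_ * _).
by rewrite -[RHS]/(fine 1%E); congr fine; exact: probability_setT.
Qed.

Lemma Rintegral_indic A : measurable A -> \int[m]_x \1_A x = fine (m A).
Proof. by move=> mA; rewrite /Rintegral integral_indic// setIT. Qed.

Lemma EFin_Rintegral f : bmeas f -> (\int[m]_x (f x)%:E)%E = (\int[m]_x f x)%:E.
Proof. by move=> bf; rewrite fineK//; exact/integrable_fin_num/integrable_bmeas. Qed.

End bounded_measurable.

Lemma nat_sqrt n : exists m, (m * m <= n < m.+1 * m.+1)%N.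
Proof.
elim: n => [|n [m /andP[mn nm]]]; first by exists 0%N.
have [->|] := eqVneq n.+1 (m.+1 * m.+1)%N; first by exists m.+1; lia.
by move=> nE; exists m; lia.
Qed.

Section slln.
Context d (Om : measurableType d) (R : realType) (P : probability Om R).
Variables (A : nat -> set Om) (p : R).
Hypothesis mA : forall i, measurable (A i).
Hypothesis PA : forall i, P (A i) = p%:E.
Hypothesis indA : forall i j, i != j -> P (A i `&` A j) = (p * p)%:E.

(* The second moments of the averages are summable along the squares, and the
   counts are monotone, which controls the averages in between. *)
Let S n w : R := \sum_(i < n) (\1_(A i) w - p).

Let p01 : 0 <= p <= 1.
Proof. by rewrite -!lee_fin -(PA 0) measure_ge0 probability_le1. Qed.

Let bX i : bmeas (fun w => \1_(A i) w - p : R).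
Proof. by apply: bmeasD; [exact: bmeas_indic|exact: bmeas_cst]. Qed.

Let bS n : bmeas (S n).
Proof. exact: bmeas_sum. Qed.

Lemma Rintegral_centered i j :
  \int[P]_w ((\1_(A i) w - p) * (\1_(A j) w - p)) = if i == j then p - p * p else 0.
Proof.
under eq_Rintegral => w _.
  rewrite (_ : _ * _ = \1_(A i `&` A j) w + (- p * \1_(A i) w + (- p * \1_(A j) w + p * p))).
    over.
  by rewrite indicI/=; ring.
have bAi k := @bmeas_indic _ _ R _ (mA k).
have mAij : measurable (A i `&` A j) by exact: measurableI.
have bij := @bmeas_indic _ _ R _ mAij.
have bZ k := bmeasZ (- p) (bAi k); have bc := @bmeas_cst _ Om R (p * p).
rewrite !Rintegral_bmeasD//; last 2 first.
  exact: bmeasD.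
  by apply: bmeasD => //; exact: bmeasD.
rewrite Rintegral_prob_cst !Rintegral_bmeasZ// !Rintegral_indic// !PA/=.
have [->|ij] := eqVneq i j; first by rewrite setIid PA/=; ring.
by rewrite indA//=; ring.
Qed.

Lemma Rintegral_sqr_sum n : \int[P]_w (S n w ^+ 2) <= n%:R.
Proof.
under eq_Rintegral => w _ do rewrite expr2 big_distrlr/=.
rewrite Rintegral_bmeas_sum => [|i]; last first.
  by apply: bmeas_sum => j; exact: bmeasM.
under eq_bigr => i _.
  rewrite Rintegral_bmeas_sum => [|j]; last exact: bmeasM.
  under eq_bigr => j _ do rewrite Rintegral_centered.
  rewrite (bigD1 i)//= eqxx big1 ?addr0 => [|j ji]; last first.
    by rewrite -val_eqE eq_sym in ji; rewrite (negbTE ji).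
  over.
rewrite sumr_const card_ord -[leRHS]mulr_natr -[leLHS]mulr_natr ler_wpM2r//.
by have := p01; nra.
Qed.

Let f m w : R := (S (m.+1 * m.+1) w / (m.+1 * m.+1)%:R) ^+ 2.

Let bf m : bmeas (f m).
Proof.
rewrite /f; under eq_fun do rewrite expr2.
have bS' : bmeas (fun w => S (m.+1 * m.+1) w / (m.+1 * m.+1)%:R).
  by apply: bmeasM => //; exact: bmeas_cst.
exact: bmeasM.
Qed.

(** With x = m+1 the mean square is at most 1/x^2, and 1/x^2 <= 2/(x(x+1)) for x >= 1; the factor 2
    buys a telescoping bound. *)
Lemma Rintegral_squares m : \int[P]_w f m w <= 2 * (m.+1%:R^-1 - m.+2%:R^-1).
Proof.
rewrite /f; under eq_Rintegral => w _ do rewrite exprMn mulrC.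
rewrite Rintegral_bmeasZ; last first.
  by under eq_fun do rewrite expr2; exact: bmeasM.
apply: (@le_trans _ _ ((m.+1 * m.+1)%:R^-1 ^+ 2 * (m.+1 * m.+1)%:R)).
  by rewrite ler_wpM2l ?exprn_ge0 ?Rintegral_sqr_sum.
have m0 : 0 < m.+1%:R :> R by rewrite ltr0n.
have m1 : 0 < m.+2%:R :> R by rewrite ltr0n.
rewrite natrM -[m.+2]addn1 natrD in m1 *; set x := m.+1%:R in m0 m1 *.
have x1 : 1 <= x by rewrite ler1n.
rewrite (_ : (x * x)^-1 ^+ 2 * (x * x) = (x * x)^-1); last by field; rewrite gt_eqF.
rewrite (_ : 2 * _ = 2 * (x * (x + 1))^-1); last by field; rewrite !gt_eqF.
rewrite -div1r ler_pdivrMr ?mulr_gt0// mulrAC ler_pdivlMr ?mulr_gt0// mul1r.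
by nra.
Qed.

(** The series of the [f m] has integral at most 2, so it is finite almost everywhere and its terms
    tend to 0. *)
Lemma ae_squares : {ae P, forall w, f ^~ w @ \oo --> (0 : R)}.
Proof.
have f0 m w : (0 <= (f m w)%:E)%E by rewrite lee_fin sqr_ge0.
have mf m : measurable_fun setT (EFin \o f m).
  by apply/measurable_EFinP; case: (bf m).
pose g w := (\sum_(m <oo) (f m w)%:E)%E.
have g0 w : (0 <= g w)%E by exact: nneseries_ge0.
have mg : measurable_fun setT g.
  apply: (ge0_emeasurable_sum (h := fun m w => (f m w)%:E) (P := xpredT)).
    by move=> k x _ _; exact: f0.
  by move=> k _; exact: mf.
have ig : P.-integrable setT g.
  apply/integrableP; split => //.
  under eq_integral do rewrite gee0_abs//.
  apply: (@le_lt_trans _ _ 2%:E); last exact: ltry.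
  rewrite /g integral_nneseries//.
  apply: lime_le; first by apply: is_cvg_nneseries => n _ _; exact: integral_ge0.
  apply: nearW => n.
  under eq_bigr do rewrite EFin_Rintegral//.
  rewrite sumEFin lee_fin.
  apply: (@le_trans _ _ (\sum_(0 <= m < n) (2 * (m.+1%:R^-1 - m.+2%:R^-1)))).
    by apply: ler_sum => m _; exact: Rintegral_squares.
  rewrite -mulr_sumr.
  under eq_bigr do rewrite -opprB.
  rewrite sumrN telescope_sumr// opprB invr1.
  by rewrite ler_piMr// lerBlDr lerDl.
have [B [mB PB0 NB]] := integrable_ae measurableT ig.
exists B; split=> // w nw; apply: NB => /= /(_ I) gw; apply: nw.
apply: cvg_series_cvg_0; apply: nondecreasing_is_cvgn.
  by apply: nondecreasing_series => m _ _; exact: sqr_ge0.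
exists (fine (g w)) => _ [n _ <-]; rewrite -lee_fin fineK// /series/= -sumEFin.
by apply: nneseries_lim_ge.
Qed.

Lemma ae_freq : {ae P, forall w, (fun n => (\sum_(i < n) \1_(A i) w) / n%:R) @ \oo --> p}.
Proof.
have [B [mB PB0 NB]] := ae_squares.
exists B; split=> // w nw; apply: NB => /= fw; apply: nw.
pose K n : R := \sum_(i < n) \1_(A i) w.
have KS n : (0 < n)%N -> K n / n%:R - p = S n w / n%:R.
  move=> n0; rewrite /S big_split/= sumr_const card_ord mulrDl; congr (_ + _).
  by rewrite -[- p *+ n]mulr_natr mulfK// pnatr_eq0 -lt0n.
have le_size m (C : nat -> set Om) : \sum_(i < m) \1_(C i) w <= m%:R :> R.
  apply: (@le_trans _ _ (\sum_(i < m) 1)); last by rewrite sumr_const card_ord.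
  by apply: ler_sum => i _; rewrite indicE lern1 leq_b1.
have Kn n : 0 <= K n <= n%:R.
  apply/andP; split; first by apply: sumr_ge0.
  exact: le_size.
have Kmono a b : (a <= b)%N -> K a <= K b <= K a + (b - a)%:R.
  move=> ab; rewrite -(subnKC ab) /K big_split_ord/= addKn; apply/andP; split.
    by rewrite lerDl sumr_ge0.
  by rewrite lerD2l; exact: (le_size _ (fun i => A (a + i)%N)).
apply/cvgrPdist_le => e e0.
have e20 : 0 < e / 2 by rewrite divr_gt0.
have [M _ MP] : \forall m \near \oo, f m w <= (e / 2) ^+ 2.
  move/cvgrPdist_le : fw => /(_ ((e / 2) ^+ 2)); rewrite exprn_gt0// => /(_ isT).
  by apply: filterS => m; rewrite sub0r normrN ger0_norm// sqr_ge0.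
(* Passing from a square to [n] costs at most [2 / m.+1], hence the quarter. *)
have [M' _ MP'] : \forall m \near \oo, m.+1%:R^-1 <= e / 4.
  near=> m; apply: ltW; near: m.
  by apply: (near_infty_natSinv_lt (PosNum (_ : 0 < e / 4))); rewrite divr_gt0.
(* Large enough for the integer square root of [n] to exceed [M] and [M'], so that its predecessor,
   the index in [f], is still at least both. *)
exists ((maxn M M').+2 * (maxn M M').+2)%N => // n /= nM.
have [m /andP[mn nm]] := nat_sqrt n.
have Mm : (maxn M M' < m)%N by nia.
case: m => [//|m] in mn nm Mm *.
have n0 : (0 < n)%N by lia.
have q0 : 0 < (m.+1 * m.+1)%:R :> R by rewrite ltr0n.
have n0' : 0 < n%:R :> R by rewrite ltr0n.
have H1 : `|K (m.+1 * m.+1)%N / (m.+1 * m.+1)%:R - p| <= e / 2.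
  rewrite KS// -(@ler_pXn2r _ 2)// ?nnegrE ?(ltW e20)// -normrX ger0_norm ?sqr_ge0//.
  by apply: MP => /=; move: Mm; clear; lia.
(* With q the square below [n] and t = K q / q in [0, 1], the quantity K n - t n is at most n - q in
   absolute value. Here n - q <= 2 (m+1) and n >= (m+1)^2. *)
have H2 : `|K n / n%:R - K (m.+1 * m.+1)%N / (m.+1 * m.+1)%:R| <= 2 * m.+1%:R^-1.
  have qn : (m.+1 * m.+1 <= n)%N by lia.
  have /andP[aK bK] := Kmono _ _ qn; have /andP[a0 aq] := Kn (m.+1 * m.+1)%N.
  have nq : n%:R = (m.+1 * m.+1)%:R + (n - m.+1 * m.+1)%:R :> R by rewrite -natrD subnKC.
  set t := K (m.+1 * m.+1)%N / (m.+1 * m.+1)%:R.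
  have tE : K (m.+1 * m.+1)%N = t * (m.+1 * m.+1)%:R by rewrite /t divfK ?gt_eqF.
  have t0 : 0 <= t by rewrite divr_ge0.
  have t1 : t <= 1 by rewrite ler_pdivrMr// mul1r.
  have d0 : 0 <= (n - m.+1 * m.+1)%:R :> R by [].
  have E : K n / n%:R - t = (K n - t * n%:R) / n%:R.
    by rewrite mulrBl mulfK// gt_eqF.
  rewrite E normrM normfV (ger0_norm (ltW n0')) ler_pdivrMr//.
  apply: (@le_trans _ _ (n - m.+1 * m.+1)%:R).
    by rewrite ler_norml nq; apply/andP; split; nra.
  apply: (@le_trans _ _ (2 * m.+1%:R)); first by rewrite -natrM ler_nat; move: nm; clear; lia.
  rewrite -mulrA ler_wpM2l// ler_pdivlMl ?ltr0n// -natrM ler_nat//.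
have H3 : m.+1%:R^-1 <= e / 4 by apply: MP' => /=; move: Mm; clear; lia.
rewrite -/(K n) distrC.
apply: le_trans (ler_distD (K (m.+1 * m.+1)%N / (m.+1 * m.+1)%:R) _ _) _.
apply: le_trans (lerD H2 H1) _; move: H3; move: (m.+1%:R^-1) => u u0; lra.
Unshelve. all: by end_near. Qed.

End slln.

(** * From frequencies of events to averages of functions *)

Definition staircase (R : realType) (h : R) (K : nat) (y : R) : R :=
  \sum_(j < K) h * (y > j.+1%:R * h)%R%:R.

Lemma staircase_bounds (R : realType) (h : R) K y : 0 < h -> 0 <= y ->
  y <= K.+1%:R * h -> y - h <= staircase h K y <= y.
Proof.
move=> h0 y0 yK.
(* The minimum replaces the upper bound on [y], so that induction on [K] applies; the second clause
   ensures that one more step stays below [y]. *)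
suff : [/\ staircase h K y <= y, staircase h K y <= K%:R * h
         & Num.min y (K.+1%:R * h) - h <= staircase h K y].
  by rewrite min_l// => -[-> _ ->].
elim: K {yK} => [|K [IH1 IH2 IH3]].
  rewrite /staircase big_ord0 mul0r mul1r; split=> //.
  by rewrite subr_le0 ge_min lexx orbT.
rewrite /staircase big_ord_recr/= -/(staircase h K y).
move: IH1 IH2 IH3; rewrite -[in K.+2%:R]addn1 natrD.
have -> : K.+1%:R = K%:R + 1 :> R by rewrite -natr1.
move: (staircase h K y) (K%:R) => s k.
have [yk|yk] := ltP ((k + 1) * h) y.
  rewrite mulr1 => IH1 IH2 IH3.
  split; [nra|nra|].
  have : Num.min y ((k + 1 + 1) * h) <= (k + 1 + 1) * h by rewrite ge_min lexx orbT.
  by nra.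
rewrite mulr0 addr0 => IH1 IH2 IH3.
split=> //; first by nra.
by rewrite min_l//; nra.
Qed.

Section average.
Context d (T : measurableType d) (R : realType) (mu : probability T R).
Context d0 (Om : measurableType d0) (P : probability Om R).
Variable Zs : nat -> {RV P >-> T}.
Hypothesis iidZ : iid_with_law Zs mu.
Variable B : nat -> set T.
Hypothesis mB : forall k, measurable (B k).

Lemma ae_freq_iid (A : set T) : measurable A ->
  {ae P, forall w, (fun n => (\sum_(i < n) \1_A (Zs i w)) / n%:R) @ \oo --> fine (mu A)}.
Proof.
move=> mA; have [indZ lawZ] := iidZ.
have mZA i : measurable (Zs i @^-1` A).
  by rewrite -[X in measurable X]setTI; exact: measurable_funPT.
have PZ i : P (Zs i @^-1` A) = (fine (mu A))%:E.
  by rewrite fineK ?fin_num_measure// -(lawZ i)//.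
apply: (@ae_freq _ _ _ P (fun i => Zs i @^-1` A)) => // i j ij.
have := indZ [fset i; j]%fset (fun=> A) (fun=> mA).
rewrite big_fsetU1/= ?inE// big_seq_fset1 !PZ -EFinM => <-; congr (P _).
apply/seteqP; split=> w /=.
  by move=> [wi wj] k /=; rewrite !inE => /orP[]/eqP->.
by move=> H; split; apply: H; rewrite /= !inE eqxx ?orbT.
Qed.

Definition cgen (U : set T) := exists D : set nat, U = \bigcup_(k in D) B k.

Lemma cgen_measurable U : cgen U -> measurable U.
Proof. by move=> [D ->]; exact: bigcup_measurable. Qed.

Definition Bunion (s : seq nat) := \big[setU/set0]_(k <- s) B k.

Lemma BunionP s t : Bunion s t <-> exists2 k, k \in s & B k t.
Proof. by rewrite /Bunion -bigcup_seq; split=> -[k ks Bt]; exists k. Qed.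

Lemma measurable_Bunion s : measurable (Bunion s).
Proof. exact: bigsetU_measurable. Qed.

(** Finite lists of indices are countable, so one null set serves all finite unions. *)
Lemma ae_freq_Bunion : {ae P, forall w, forall s : seq nat,
  (fun n => (\sum_(i < n) \1_(Bunion s) (Zs i w)) / n%:R) @ \oo --> fine (mu (Bunion s))}.
Proof.
have : {ae P, forall w, forall k : nat,
  let s := odflt [::] (@choice.unpickle (seq nat) k) in
  (fun n => (\sum_(i < n) \1_(Bunion s) (Zs i w)) / n%:R) @ \oo --> fine (mu (Bunion s))}.
  by apply: ae_foralln => k; exact/ae_freq_iid/measurable_Bunion.
apply: filterS => w H s; by have := H (choice.pickle s); rewrite (choice.pickleK s).
Qed.

Section path.
Variable z : nat -> T.
Hypothesis zB : forall s : seq nat,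
  (fun n => (\sum_(i < n) \1_(Bunion s) (z i)) / n%:R) @ \oo --> fine (mu (Bunion s)).

(** Finite unions exhaust [U], their frequencies converge, and the frequency of [U] dominates
    theirs: the open-set half of the portmanteau theorem. *)
Lemma freq_ge U (e : R) : cgen U -> 0 < e ->
  \forall n \near \oo, fine (mu U) - e <= (\sum_(i < n) \1_U (z i)) / n%:R.
Proof.
move=> [D UD] e0.
pose s n := [seq k <- iota 0 n | `[< D k >]].
have sU n : Bunion (s n) `<=` U.
  move=> t /BunionP[k]; rewrite mem_filter => /andP[/asboolP Dk _] Bt.
  by rewrite UD; exists k.
have mU : measurable U by rewrite UD; exact: bigcup_measurable.
have [n sn] : exists n, fine (mu U) - e / 2 <= fine (mu (Bunion (s n))).
  have : (mu \o (Bunion \o s)) @ \oo --> mu (\bigcup_n (Bunion \o s) n).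
    apply: nondecreasing_cvg_mu => //.
    - by move=> k; exact: measurable_Bunion.
    - by apply: bigcupT_measurable => k; exact: measurable_Bunion.
    - move=> a b ab; apply/subsetPset => t /BunionP[k].
      rewrite mem_filter mem_iota/= => /andP[Dk ka] Bt; apply/BunionP; exists k => //.
      by rewrite mem_filter mem_iota Dk/=; lia.
  rewrite (_ : \bigcup_n _ = U); last first.
    apply/seteqP; split=> [t [k _]|t]; first exact: sU.
    rewrite {1}UD => -[k Dk Bt]; exists k.+1 => //; apply/BunionP.
    by exists k => //; rewrite mem_filter mem_iota/= add0n ltnSn andbT; apply/asboolP.
  have muUE : mu U = (fine (mu U))%:E by rewrite fineK ?fin_num_measure.
  rewrite muUE => /fine_cvg/cvgrPdist_le/(_ (e / 2)).
  rewrite divr_gt0// => /(_ isT)[n _ /(_ n (leqnn n))].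
  by rewrite ler_norml => /andP[_ /= H]; exists n; lra.
have /cvgrPdist_le/(_ (e / 2)) := @zB (s n); rewrite divr_gt0// => /(_ isT).
apply: filterS => k; rewrite ler_norml => /andP[_ H].
have : (\sum_(i < k) \1_(Bunion (s n)) (z i)) / k%:R <= (\sum_(i < k) \1_U (z i)) / k%:R :> R.
  rewrite ler_wpM2r ?invr_ge0// ler_sum// => i _; rewrite !indicE ler_nat.
  by case: (boolP (_ \in Bunion _)) => //; rewrite inE => /sU tU; rewrite mem_set.
lra.
Qed.

Lemma average_ge (f : T -> R) (e : R) : bmeas f ->
  (forall r, cgen [set x | r < f x]) -> 0 < e ->
  \forall n \near \oo, \int[mu]_x f x - e <= (\sum_(i < n) f (z i)) / n%:R.
Proof.
move=> bf cf e0; have [mf [M fM]] := bf.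
have h0 : 0 < e / 2 by rewrite divr_gt0.
set h := e / 2 in h0.
(* Enough steps for the staircase to cover [0, 2|M|], the range of the shifted function [y]. *)
pose K := Num.bound (2 * `|M| / h).
have K2M : 2 * `|M| <= K.+1%:R * h.
  rewrite -ler_pdivrMr//; apply: le_trans (ltW (archi_boundP _)) _.
    by rewrite divr_ge0 ?mulr_ge0// ltW.
  by rewrite ler_nat.
pose y x := f x + `|M|.
have y0 x : 0 <= y x by have := fM x; rewrite /y ler_norml => /andP[+ _]; have := ler_norm M; lra.
have yK x : y x <= K.+1%:R * h.
  by apply: le_trans K2M; have := fM x; rewrite /y ler_norml => /andP[_]; have := ler_norm M; lra.
have st x := staircase_bounds h0 (y0 x) (yK x).
pose U j := [set x | j.+1%:R * h - `|M| < f x].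
have cU j : cgen (U j) by exact: cf.
have mU j := cgen_measurable (cU j).
have stE x : staircase h K (y x) = \sum_(j < K) h * \1_(U j) x.
  apply: eq_bigr => j _; congr (_ * _); rewrite indicE /y -ltrBlDr.
  suff -> : (x \in U j) = (j.+1%:R * h - `|M| < f x) by [].
  by apply/idP/idP; rewrite inE.
have bU j := @bmeas_indic _ _ R _ (mU j).
have bst : bmeas (fun x => staircase h K (y x)).
  rewrite (_ : (fun x => _) = (fun x => \sum_(j < K) h * \1_(U j) x)).
    by apply: bmeas_sum => j; exact: bmeasZ.
  by apply/funext => x; rewrite stE.
have intst : \int[mu]_x y x - h <= \sum_(j < K) h * fine (mu (U j)).
  rewrite (_ : \sum_(j < K) _ = \int[mu]_x staircase h K (y x)); last first.
    under eq_Rintegral do rewrite stE.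
    rewrite Rintegral_bmeas_sum => [|j]; last exact: bmeasZ.
    by apply: eq_bigr => j _; rewrite Rintegral_bmeasZ// Rintegral_indic.
  rewrite -[X in _ - X <= _](Rintegral_prob_cst mu h) -[X in X - _]/(\int[mu]_x (f x + `|M|)).
  rewrite -RintegralB//; last 2 first.
  - by apply: integrable_bmeas; apply: bmeasD => //; exact: bmeas_cst.
  - by apply: integrable_bmeas; exact: bmeas_cst.
  apply: le_Rintegral => //.
  - apply: integrable_bmeas; apply: bmeasD; last exact: bmeas_cst.
    by apply: bmeasD => //; exact: bmeas_cst.
  - exact: (integrable_bmeas mu bst).
  by move=> x _; have /andP[] := st x.
(* The tolerance for each of the [K] superlevel sets: with weights [h] the errors add up to at most
   [h], and the mesh costs another [h = e / 2]. *)
have c0 : 0 < K.+1%:R^-1 :> R by rewrite invr_gt0 ltr0n.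
have ev : \forall n \near \oo, forall j : 'I_K,
    fine (mu (U j)) - K.+1%:R^-1 <= (\sum_(i < n) \1_(U j) (z i)) / n%:R.
  by apply: filter_forall => j; exact: freq_ge.
near=> n.
have n0 : (0 < n)%N by near: n; exists 1%N.
have n0' : n%:R != 0 :> R by rewrite pnatr_eq0 -lt0n.
have avg : (\sum_(i < n) y (z i)) / n%:R = (\sum_(i < n) f (z i)) / n%:R + `|M|.
  by rewrite big_split/= sumr_const card_ord -[_ *+ n]mulr_natr mulrDl mulfK.
have inty : \int[mu]_x y x = \int[mu]_x f x + `|M|.
  by rewrite Rintegral_bmeasD ?Rintegral_prob_cst//; exact: bmeas_cst.
rewrite -(lerD2r `|M|) -avg addrAC -inty.
apply: (@le_trans _ _ ((\sum_(i < n) staircase h K (y (z i))) / n%:R)); last first.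
  rewrite ler_wpM2r ?invr_ge0// ler_sum// => i _.
  by have /andP[] := st (z i).
under eq_bigr do rewrite stE.
rewrite exchange_big/= mulr_suml.
under eq_bigr do rewrite -mulr_sumr -mulrA.
have evn : forall j : 'I_K,
    fine (mu (U j)) - K.+1%:R^-1 <= (\sum_(i < n) \1_(U j) (z i)) / n%:R.
  by near: n.
apply: (@le_trans _ _ (\sum_(j < K) h * (fine (mu (U j)) - K.+1%:R^-1))); last first.
  by apply: ler_sum => j _; rewrite ler_pM2l.
under eq_bigr do rewrite mulrBr.
rewrite sumrB sumr_const card_ord.
have hK : h * K.+1%:R^-1 *+ K <= h.
  rewrite -[_ *+ K]mulr_natr -mulrA ger_pMr//.
  by rewrite mulrC ler_pdivrMr ?ltr0n// mul1r ler_nat.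
by rewrite [e]splitr opprD addrA; exact: lerB intst hK.
Unshelve. all: by end_near. Qed.

(** The lower bound is applied to [f] and to its opposite, whose superlevel sets are sublevel sets
    of [f]. *)
Lemma average_cvg (f : T -> R) : bmeas f ->
  (forall r, cgen [set x | r < f x]) -> (forall r, cgen [set x | f x < r]) ->
  (fun n => (\sum_(i < n) f (z i)) / n%:R) @ \oo --> \int[mu]_x f x.
Proof.
move=> bf fl fu; apply/cvgrPdist_le => e e0.
have bNf : bmeas (fun x => -1 * f x) by exact: bmeasZ.
have NfB r : cgen [set x | r < -1 * f x].
  rewrite (_ : [set x | _] = [set x | f x < - r]); first exact: fu.
  by apply/seteqP; split=> x /=; rewrite mulN1r ltrNr.
have := average_ge bNf NfB e0; rewrite Rintegral_bmeasZ// => H.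
near=> n.
have : \int[mu]_x f x - e <= (\sum_(i < n) f (z i)) / n%:R by near: n; exact: average_ge.
have : -1 * \int[mu]_x f x - e <= (\sum_(i < n) -1 * f (z i)) / n%:R by near: n.
rewrite -mulr_sumr -mulrA !mulN1r ler_norml; lra.
Unshelve. all: by end_near. Qed.

End path.

End average.

(** * Empirical measures *)

Section full_set.
Import HBNNSimple.
Context d (T : measurableType d) (R : realType) (m : probability T R).
Implicit Types (D : set T) (g h : T -> \bar R).
Local Open Scope ereal_scope.

(** No measurability is assumed, the integral being a supremum over simple functions below; this
    covers functions patched by 0 outside an arbitrary [D]. *)
Lemma ge0_le_integralT g h : (forall x, 0 <= g x) -> (forall x, g x <= h x) ->
  \int[m]_x g x <= \int[m]_x h x.
Proof.
move=> g0 gh; rewrite !ge0_integralTE// => [|x]; last exact: le_trans (g0 x) (gh x).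
apply: ereal_sup_le => _ [k kg <-]; exists k => // x.
exact: le_trans (kg x) (gh x).
Qed.

(* [D] is not assumed measurable: the integral of a nonnegative function over
   [D] is then a supremum over simple functions, so that [\int_D 1] is the inner
   measure of [D]. *)
Lemma measurable_core D : \int[m]_(x in D) 1 = 1 ->
  exists B, [/\ measurable B, B `<=` D & m B = 1].
Proof.
move=> D1.
have approx (n : nat) : exists B, [/\ measurable B, B `<=` D & (1 - n.+1%:R^-1)%:E <= m B].
  have : (1 - n.+1%:R^-1)%:E < \int[m]_(x in D) 1 by rewrite D1 lte_fin ltrBlDr ltrDl.
  rewrite integral_mkcond ge0_integralTE; last by move=> x; rewrite /patch; case: ifP.
  move=> /ereal_sup_gt[_ [k kD <-] nk].
  have k1 x : (k x <= \1_D x)%R.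
    have := kD x; rewrite /patch indicE; case: ifP => _; by rewrite lee_fin.
  (* The set where the simple function [k] is positive: [k <= \1_D] puts it inside [D], and [k] is
     at most its indicator, which bounds its mass from below. *)
  exists (k @^-1` `]0%R, +oo[%classic); split.
  - by rewrite -[X in measurable X]setTI; exact: measurable_funPT.
  - move=> x /=; rewrite in_itv/= andbT => k0.
    have := lt_le_trans k0 (k1 x); rewrite indicE; case: (boolP (x \in D)) => [/set_mem//|_].
    by rewrite ltxx.
  have mB : measurable (k @^-1` `]0%R, +oo[%classic).
    by rewrite -[X in measurable X]setTI; exact: measurable_funPT.
  apply: le_trans (ltW nk) _; rewrite -integralT_nnsfun -[X in _ <= m X]setIT -integral_indic//.
  apply: ge0_le_integralT => x; first by rewrite lee_fin.
  rewrite lee_fin indicE; have [k0|k0] := ltP 0%R (k x).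
    rewrite mem_set; last by rewrite /= in_itv/= k0.
    by apply: le_trans (k1 x) _; rewrite indicE lern1 leq_b1.
  by apply: le_trans k0 _; rewrite ler0n.
have /choice[B BP] := approx.
have mB : measurable (\bigcup_n B n) by apply: bigcupT_measurable => n; have [] := BP n.
exists (\bigcup_n B n); split=> //; first by move=> x [n _]; have [_ + _] := BP n; exact.
apply/eqP; rewrite eq_le probability_le1//=; apply/lee_addgt0Pr => e e0.
near \oo => n.
have [mBn _ Bn] := BP n.
apply: (@le_trans _ _ ((1 - n.+1%:R^-1)%:E + e%:E)).
  rewrite -EFinD lee_fin -lerBlDl opprB addrC subrK.
  by apply: ltW; near: n; exact: near_infty_natSinv_lt (PosNum e0).
rewrite leeD2r//; apply: le_trans Bn _; apply: le_measure; rewrite ?inE//.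
by move=> x Bx; exists n.
Unshelve. all: by end_near. Qed.

(** The integral over [D] lies between those over [B] and over the whole space, which agree since
    the complement of [B] is null. *)
Lemma ge0_integral_full B D h : measurable B -> B `<=` D -> m B = 1 ->
  measurable_fun setT h -> (forall x, 0 <= h x) ->
  \int[m]_(x in D) h x = \int[m]_x h x.
Proof.
move=> mB BD B1 mh h0; apply/eqP; rewrite integral_mkcond eq_le; apply/andP; split.
  by apply: ge0_le_integralT => x; rewrite /patch; case: ifP.
have B0 : m (~` B) = 0.
  by rewrite probability_setC// B1 subee.
rewrite [X in X <= _](ge0_negligible_integral _ _ _ _ B0)//; last exact: measurableC.
rewrite setTD setCK integral_mkcond.
apply: ge0_le_integralT => x; rewrite /patch; first by case: ifP.
case: ifPn => [/set_mem/BD Dx|_]; first by rewrite mem_set.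
by case: ifP.
Qed.

End full_set.

Lemma Rintegral_full d (T : measurableType d) (R : realType) (m : probability T R)
    (D : set T) (f : T -> R) :
  \int[m]_(x in D) 1 = 1 -> measurable_fun setT f ->
  \int[m]_(x in D) f x = \int[m]_x f x.
Proof.
move=> D1 mf.
have iD0 : (0 <= \int[m]_(x in D) 1)%E by exact: integral_ge0.
(* [fine] sends infinite values to 0, so the real value 1 forces the extended integral to be 1. *)
have iD1 : (\int[m]_(x in D) 1 = 1)%E.
  move: D1; rewrite /Rintegral; move: iD0.
  case: (integral _ _ _) => [r _ /= ->//|_ /= /esym/eqP|//].
  by rewrite oner_eq0.
have [B [mB BD B1]] := measurable_core iD1.
have mEf : measurable_fun setT (EFin \o f) by exact/measurable_EFinP.
rewrite /Rintegral integralE [in RHS]integralE; congr (fine (_ - _)%E).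
  by apply: ge0_integral_full BD B1 _ _ => //; exact: measurable_funepos.
by apply: ge0_integral_full BD B1 _ _ => //; exact: measurable_funeneg.
Qed.

Lemma measurable_gt d (T : measurableType d) (R : realType) (f : T -> R) :
  (forall r, measurable [set x | r < f x]) -> measurable_fun setT f.
Proof.
move=> mf; apply: (measurability _ (RGenOInfty.measurableE R)) => //.
move=> _ [_ [r ->] <-]; rewrite setTI.
rewrite (_ : _ @^-1` _ = [set x | r < f x])//.
by apply/seteqP; split => x /=; rewrite in_itv/= andbT.
Qed.

Lemma continuous_bmeas (R : realType) (Y : ptopologicalType) (f : borel Y -> R) :
  bounded_continuous (f : Y -> R) -> bmeas f.
Proof.
move=> [cf bf]; split=> //; apply: measurable_gt => r.
apply: sub_sigma_algebra.
rewrite (_ : [set x | _] = (f : Y -> R) @^-1` [set y | r < y])//.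
by apply: open_comp; [move=> x _; exact: cf|exact: open_gt].
Qed.

Section empirical.
Context (R : realType) (Y : ptopologicalType).

Lemma atomic_empirical (y : nat -> Y) n : (0 < n)%N ->
  atomic (empirical R y n) [seq (n%:R^-1, y i : borel Y) | i : 'I_n <- index_enum 'I_n].
Proof.
move=> n0 A mA; rewrite empiricalE// /wsum big_map.
by rewrite -mulr_sumr EFinM -sumEFin.
Qed.

Lemma Rintegral_empirical (y : nat -> Y) n (f : Y -> R) : (0 < n)%N ->
  bounded_continuous f ->
  \int[empirical R y n]_x f x = (\sum_(i < n) f (y i)) / n%:R.
Proof.
move=> n0 bf; have [mf bdf] := continuous_bmeas bf.
rewrite (Rintegral_atomic (atomic_empirical y n0) mf bdf) /wsum big_map.
by rewrite mulrC mulr_sumr.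
Qed.

Lemma empirical_cvg (y : nat -> Y) (m : Pr R Y) :
  (forall f : Y -> R, bounded_continuous f ->
    (fun n => (\sum_(i < n) f (y i)) / n%:R) @ \oo --> \int[m]_x f x) ->
  empirical R y @ \oo --> m.
Proof.
move=> H; apply/narrow_cvgP => f bf.
suff : (fun n => \int[empirical R y n]_x f x) @ \oo --> \int[m]_x f x by [].
have := @H f bf; apply: cvg_trans; apply: near_eq_cvg; exists 1%N => // n /= n0.
by rewrite /= Rintegral_empirical.
Qed.

(** The narrow topology does not separate records that agree on Borel sets: the constant sequence
    [l] converges to [l']. *)
Lemma meas_eq_continuous (Phi : Pr R Y -> R) (l l' : Pr R Y) :
  continuous Phi -> meas_eq l l' -> Phi l = Phi l'.
Proof.
move=> cPhi ll'.
have : (fun _ : nat => l) @ \oo --> l'.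
  apply/narrow_cvgP => f _.
  rewrite [X in _ --> X](_ : _ = \int[l]_y f y); last exact/esym/eq_Rintegral_measure.
  exact: cvg_cst.
move=> /(cvg_comp _ _)/(_ (cPhi l')) /cvg_lim <- //.
by apply/esym/cvg_lim => //; exact: cvg_cst.
Qed.

End empirical.

Section Lam.
Context (R : realType) (X : ptopologicalType) (N : nat).
Hypothesis N0 : (0 < N)%N.

Lemma continuous_tnth i : continuous (fun t : tuple_top N X => tnth t i).
Proof.
move=> t; have := @cvg_id _ (nbhs t).
move=> /(cvg_initial (fun t : N.-tuple X => (tnth t : {ptws 'I_N -> X}))).
by move=> /cvg_ptws; exact.
Qed.

Lemma Rintegral_Lam (x : N.-tuple X) (f : X -> R) : bounded_continuous f ->
  \int[Lam R x]_y f y = (\sum_(i < N) f (tnth x i)) / N%:R.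
Proof.
move=> bf; rewrite Rintegral_empirical//; congr (_ / _).
by apply: eq_bigr => i _; rewrite (tnth_nth point).
Qed.

Lemma continuous_Lam : continuous (fun x : tuple_top N X => Lam R x).
Proof.
move=> x; apply/(narrow_cvgP _ (fmap_filter _ (nbhs_filter x))) => f bf.
have [cf _] := bf.
suff : (fun y : tuple_top N X => \int[Lam R y]_z f z) @ nbhs x --> \int[Lam R x]_z f z by [].
rewrite Rintegral_Lam//; under eq_fun do rewrite Rintegral_Lam//.
apply: cvgM; last exact: cvg_cst.
apply: cvg_big => [|i _]; first exact: add_continuous.
apply: (@cvg_comp _ _ _ (fun t : tuple_top N X => tnth t i) f); last exact: cf.
exact: continuous_tnth.
Qed.

Lemma bounded_continuous_Lam (Phi : Pr R X -> R) : bounded_continuous Phi ->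
  bounded_continuous (fun x : tuple_top N X => Phi (Lam R x)).
Proof.
move=> [cPhi [M PhiM]]; split; last by exists M.
by move=> x; apply: continuous_comp; [exact: continuous_Lam|exact: cPhi].
Qed.

Lemma perm_Lam (x y : N.-tuple X) : perm_eq x y -> meas_eq (Lam R x) (Lam R y).
Proof.
move=> xy A mA; rewrite !empiricalE//; congr (_ * _)%E.
have E (z : N.-tuple X) :
    (\sum_(i < N) \d_(nth point z i : borel X) A = \sum_(u <- z) \d_(u : borel X) A)%E.
  by rewrite (big_nth point) size_tuple big_mkord.
by rewrite !E; exact: perm_big.
Qed.

Lemma atomic_Lam (x : N.-tuple X) : atomic (Lam R x)
  [seq (N%:R^-1, tnth x i : borel X) | i <- index_enum 'I_N].
Proof.
rewrite (eq_map (g := fun i : 'I_N => (N%:R^-1, nth point x i : borel X))).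
  exact: atomic_empirical.
by move=> i; rewrite (tnth_nth point).
Qed.

Lemma charge_int_Fmeas (Phi : Pr R X -> R) (l : Pr R X) (x : N.-tuple X) :
  bounded_continuous Phi -> meas_eq l (Lam R x) ->
  bmeas (fun y : N.-tuple (borel X) => Phi (Lam R y)) ->
  charge_int (Fmeas N N l) (fun y => Phi (Lam R y)) = Phi l.
Proof.
move=> [cPhi _] lx [mphi bphi].
have lat : atomic l [seq (N%:R^-1, tnth x i : borel X) | i <- index_enum 'I_N].
  by move=> A mA; rewrite lx//; exact: atomic_Lam.
have [s Fs sE] := sym_atomic_Fmeas lat N0.
rewrite (charge_int_atomic Fs mphi bphi).
(* [sym_atomic] tests functions on words of every length; the default 0 at other lengths keeps [g]
   symmetric, as permuted words have equal length. *)
pose g (z : seq (borel X)) := if size z == N then Phi (empirical R (nth point z) N) else 0.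
have sg : sym_fun g.
  move=> z z' zz'; rewrite /g -(perm_size zz'); case: eqP => // zN.
  apply: meas_eq_continuous cPhi _.
  pose t : N.-tuple X := tcast zN (in_tuple z).
  pose t' : N.-tuple X := tcast (etrans (esym (perm_size zz')) zN) (in_tuple z').
  have tz : tval t = z by rewrite val_tcast.
  have tz' : tval t' = z' by rewrite val_tcast.
  by have := @perm_Lam t t'; rewrite /Lam tz tz'; apply.
transitivity (wsum s (g \o val)).
  by apply: eq_bigr => u _; rewrite /= /g size_tuple eqxx.
rewrite sE// /g size_map size_enum_ord eqxx.
rewrite (meas_eq_continuous cPhi lx) /Lam.
by rewrite map_tnth_enum.
Qed.

End Lam.

(** * A countable base of X^N and the conclusion *)

Lemma tuple_countable_base (R : realType) (X : ptopologicalType) (N : nat) : polish R X ->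
  exists B : nat -> set (N.-tuple (borel X)), (forall k, measurable (B k)) /\
    forall U : set (tuple_top N X), open U -> cgen B U.
Proof.
move=> [[D cD dD] [dist [dist0 distC distT nbhsD _]]].
have ball_open x e : open [set y | dist x y < e].
  rewrite openE => y /= xy; apply/nbhsD; exists (e - dist x y); first by rewrite subr_gt0.
  by move=> z /=; rewrite ltrBrDl; exact: le_lt_trans.
have [f fD] : exists f : nat -> X, D `<=` range f.
  have /pfcard_geP[->|[f]] := cD; first by exists (fun=> point).
  by exists f => x Dx; have [k _ <-] := @surj _ _ _ _ f x Dx; exists k.
pose box (c : N.-tuple nat * nat) : set (tuple_top N X) :=
  \bigcap_(i in [set: 'I_N])
    (fun t => tnth t i) @^-1` [set y | dist (f (tnth c.1 i)) y < c.2.+1%:R^-1].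
have mbox c : measurable (box c : set (N.-tuple (borel X))).
  apply: fin_bigcap_measurable => // i _; rewrite -[X in measurable X]setTI.
  by apply: measurable_tnth => //; apply: sub_sigma_algebra; exact: ball_open.
pose B k := if @choice.unpickle (N.-tuple nat * nat)%type k is Some c then box c else set0.
exists B; split=> [k|U oU].
  by rewrite /B; case: choice.unpickle.
exists [set k | B k `<=` U]; apply/seteqP; split=> [t Ut|t [k /= kU]]; last exact: kU.
pose G : set_system (N.-tuple X) := filter_from setT (fun k =>
  [set s : N.-tuple X | forall i, dist (tnth t i) (tnth s i) < k.+1%:R^-1]).
have GF : Filter G.
  apply: filter_from_filter => [|a b _ _]; first by exists 0%N.
  exists (maxn a b) => // s sab; split=> i; apply: lt_le_trans (sab i) _.
    by rewrite lef_pV2 ?posrE// ler_nat ltnS leq_maxl.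
  by rewrite lef_pV2 ?posrE// ler_nat ltnS leq_maxr.
have Gt : G --> (t : tuple_top N X).
  apply/cvg_initial/cvg_ptws => i A /nbhsD[e e0 eA] /=.
  near \oo => k; exists k => // s ks; apply: eA => /=.
  apply: lt_trans (ks i) _; near: k; exact: near_infty_natSinv_lt (PosNum e0).
have [k _ kU] : G U by apply: Gt; exact: open_nbhs_nbhs.
(* This radius is less than half of 1/(k+1), so two steps through the centre [f (c i)] stay within
   the distance allowed by [kU]. *)
have Kpos : (0 : R) < (k.+1).*2.+1%:R^-1 by rewrite invr_gt0.
have /choice[c cP] : forall i, exists a, dist (f a) (tnth t i) < (k.+1).*2.+1%:R^-1.
  move=> i; have := dD [set y | dist (tnth t i) y < (k.+1).*2.+1%:R^-1] _ (ball_open _ _).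
  case; first by exists (tnth t i); rewrite /= (dist0 _ _).2.
  by move=> x [/= tx /fD[a _ ax]]; exists a; rewrite ax distC.
pose cc : (N.-tuple nat * nat)%type := ([tuple c i | i < N], (k.+1).*2).
have BE : B (choice.pickle cc) = box cc by rewrite /B choice.pickleK.
exists (choice.pickle cc); last by rewrite BE => i _; rewrite /= tnth_mktuple.
rewrite -[[set k | _] _]/(B (choice.pickle cc) `<=` U) BE.
move=> s bs; apply: kU => i; have := bs i I; rewrite /= tnth_mktuple => si.
apply: le_lt_trans (distT _ (f (c i)) _) _.
apply: lt_trans (ltrD (_ : _ < (k.+1).*2.+1%:R^-1) si) _; first by rewrite distC.
rewrite -mulr2n -[X in X < _]mulr_natl ltr_pdivrMr// mulrC ltr_pdivlMr//.
by rewrite -natrM ltr_nat; lia.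
Unshelve. all: by end_near. Qed.

Lemma bounded_continuous_tuple (R : realType) (X : ptopologicalType) (N : nat)
    (B : nat -> set (N.-tuple (borel X))) (phi : tuple_top N X -> R) :
  (forall k, measurable (B k)) ->
  (forall U : set (tuple_top N X), open U -> cgen B U) -> bounded_continuous phi ->
  [/\ bmeas (phi : N.-tuple (borel X) -> R), forall r, cgen B [set x | r < phi x]
    & forall r, cgen B [set x | phi x < r]].
Proof.
move=> mB oB [cphi bphi].
have gt r : cgen B [set x | r < phi x].
  by apply: oB; apply: (@open_comp _ _ phi [set y | r < y]) => [x _|]; [exact: cphi|exact: open_gt].
have lt r : cgen B [set x | phi x < r].
  by apply: oB; apply: (@open_comp _ _ phi [set y | y < r]) => [x _|]; [exact: cphi|exact: open_lt].
split=> //; split=> //; apply: measurable_gt => r.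
exact: (cgen_measurable mB (gt r)).
Qed.

Theorem corollary5p2 (R : realType) (X : ptopologicalType) (hX : polish R X)
  (N : nat) (hN : (2 <= N)%N)
  (d0 : measure_display) (Om0 : measurableType d0) (P0 : probability Om0 R)
  (Z : 'I_N -> {RV P0 >-> borel X}) (hZ : exchangeable Z)
  (mu : probability (N.-tuple (borel X)) R) (mu_sym : symmetric_law mu)
  (mu_law : forall A : set (N.-tuple (borel X)), measurable A ->
    mu A = P0 [set w | A [tuple Z i w | i < N]])
  (alpha : Pr R (Pr R X)) (alphaN : alpha (@Pr_frac R X N) = 1%E)
  (mu_alpha : forall phi : tuple_top N X -> R, bounded_continuous phi ->
    \int[mu]_x phi x =
    \int[alpha]_(l in @Pr_frac R X N) charge_int (Fmeas N N l) phi)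
  (d : measure_display) (Om : measurableType d) (P : probability Om R)
  (Zs : nat -> {RV P >-> N.-tuple (borel X)}) (hZs : iid_with_law Zs mu) :
  {ae P, forall w,
    empirical R (fun nu => Lam R (Zs nu w)) @ \oo --> alpha}.
Proof.
have N0 : (0 < N)%N by exact: ltnW.
have [B [mB oB]] := tuple_countable_base N hX.
have LamB (Phi : Pr R X -> R) : bounded_continuous Phi -> _ := fun bPhi =>
  bounded_continuous_tuple mB oB (bounded_continuous_Lam N0 bPhi).
have muE (Phi : Pr R X -> R) : bounded_continuous Phi ->
    \int[mu]_x Phi (Lam R x) = \int[alpha]_(l in @Pr_frac R X N) Phi l.
  move=> bPhi; rewrite (mu_alpha _ (bounded_continuous_Lam N0 bPhi)).
  apply: eq_Rintegral => l /set_mem[x lx]; apply: charge_int_Fmeas lx _ => //.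
  by have [] := LamB _ bPhi.
have frac1 : \int[alpha]_(l in @Pr_frac R X N) 1 = 1.
  have b1 : bounded_continuous (cst 1 : Pr R X -> R).
    by split; [exact: cst_continuous|exists 1 => y; rewrite normr1].
  by rewrite -(muE _ b1) Rintegral_prob_cst.
have muE' (Phi : Pr R X -> R) : bounded_continuous Phi ->
    \int[mu]_x Phi (Lam R x) = \int[alpha]_l Phi l.
  move=> bPhi; rewrite muE// (Rintegral_full frac1)//.
  by have [] := continuous_bmeas bPhi.
(* The null set comes from the family [B] alone and is fixed before [Phi]. *)
apply: filterS (ae_freq_Bunion hZs mB) => w freqw.
apply: empirical_cvg => Phi bPhi; rewrite -muE'//.
have [bLam gt lt] := LamB _ bPhi.
exact: (@average_cvg _ _ _ mu _ mB (fun i => Zs i w) freqw _ bLam gt lt).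
Qed.
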